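(* For $p\in[1,\infty)$ and $\zeta\in\mathcal{M}^{n-1}_p$ the functional $\delta_{\zeta,p}(u,v)=\left(\int_{\mathbb{R}^n}|\zeta(u(x))-\zeta(v(x))|^p\,dx\right)^{1/p}$ defines a metric on $\operatorname{Conv}_{\text{coe}}^{(n)}(\mathbb{R}^n)$. Furthermore, for every $u_k,u\in\operatorname{Conv}_{\text{coe}}^{(n)}(\mathbb{R}^n)$ we have $\delta_{\zeta,p}(u_k,u)\to 0$ if and only if $u_k$ epi-converges to $u$ as $k\to\infty$.
   Context: $\operatorname{Conv}_{\text{coe}}^{(n)}(\mathbb{R}^n)$ denotes the space of proper, lower semicontinuous, coercive, convex functions $u:\mathbb{R}^n\to\mathbb{R}\cup\{+\infty\}$ whose domain $\operatorname{dom}u=\{x: u(x)<+\infty\}$ has dimension $n$ (equivalently $0<\int e^{-u}<\infty$). For $p\in[1,\infty)$, $\mathcal{M}^{n-1}_p$ is the set of continuous, strictly decreasing functions $\zeta:\mathbb{R}\to(0,\infty)$ such that $\int_0^\infty \zeta(t)^p t^{n-1}\,dt<+\infty$; one sets $\zeta(+\infty)=0$. A sequence $u_k$ epi-converges to $u$ if for every $x$: $\liminf u_k(x_k)\ge u(x)$ for every sequence $x_k\to x$, and $\limsup u_k(x_k)\le u(x)$ for some sequence $x_k\to x$. *)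

(* Defs.v *)
From HB Require Import structures.
From mathcomp Require Import all_boot all_order all_algebra.
From mathcomp Require Import all_classical all_reals all_analysis.
Set Implicit Arguments. Unset Strict Implicit. Unset Printing Implicit Defensive.
Import Order.TTheory GRing.Theory Num.Theory.
Import numFieldNormedType.Exports.
Local Open Scope classical_set_scope.
Local Open Scope ring_scope.

Section Defs.
Variable R : realType.

Definition cons_row (n : nat) (t : R) (x : 'rV[R]_n) : 'rV[R]_n.+1 :=
  \row_(i < n.+1) match unlift ord0 i with Some j => x ord0 j | None => t end.

(* Lebesgue integral over R^n of a (nonnegative) function, as the iterated
   one-dimensional Lebesgue integral (Tonelli); R^0 is a point of mass 1. *)
Fixpoint integral_Rn (n : nat) : ('rV[R]_n -> \bar R) -> \bar R :=
  match n with
  | 0 => fun f => f 0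
  | n'.+1 => fun f =>
      integral_Rn (fun x : 'rV[R]_n' =>
        (\int[@lebesgue_measure R]_(t in [set: R]) f (cons_row t x))%E)
  end.

Definition affinely_independent (n : nat) (pts : 'I_n.+1 -> 'rV[R]_n) : Prop :=
  \det (\matrix_(i < n, j < n) (pts (lift ord0 i) - pts ord0) ord0 j) != 0.

Definition dom (n : nat) (u : 'rV[R]_n -> \bar R) : set 'rV[R]_n :=
  [set x | u x != +oo%E].

(* dim (dom u) = n, i.e. the affine hull of dom u is R^n *)
Definition full_dim_dom (n : nat) (u : 'rV[R]_n -> \bar R) : Prop :=
  exists pts : 'I_n.+1 -> 'rV[R]_n,
    (forall i, dom u (pts i)) /\ affinely_independent pts.

Definition ext_convex (n : nat) (u : 'rV[R]_n -> \bar R) : Prop :=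
  forall (x y : 'rV[R]_n) (t : R), 0 <= t <= 1 ->
    (u ((1 - t) *: x + t *: y)%R <= (1 - t)%:E * u x + t%:E * u y)%E.

Definition coercive (n : nat) (u : 'rV[R]_n -> \bar R) : Prop :=
  forall M : R, exists r : R, forall x, r < `|x| -> (M%:E < u x)%E.

Definition Conv_coe_n (n : nat) (u : 'rV[R]_n -> \bar R) : Prop :=
  [/\ (forall x, u x != -oo%E),
      (exists x, u x != +oo%E),
      lower_semicontinuous u,
      ext_convex u &
      coercive u /\ full_dim_dom u].

Definition M_class (n : nat) (p : R) (zeta : R -> R) : Prop :=
  [/\ continuous zeta,
      (forall t, 0 < zeta t),
      (forall s t, s < t -> zeta t < zeta s) &
      (\int[@lebesgue_measure R]_(t in `[0%R, +oo[)
          ((zeta t) `^ p * t ^+ n.-1)%:E < +oo)%E].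

(* zeta extended by zeta(+oo) = 0 (the value at -oo is never used) *)
Definition zeta_ext (zeta : R -> R) (y : \bar R) : R :=
  match y with EFin r => zeta r | _ => 0 end.

Definition delta (n : nat) (zeta : R -> R) (p : R)
    (u v : 'rV[R]_n -> \bar R) : \bar R :=
  ((integral_Rn (fun x =>
      (`|zeta_ext zeta (u x) - zeta_ext zeta (v x)| `^ p)%:E)) `^ p^-1)%E.

Definition epi_converges (n : nat) (uk : nat -> 'rV[R]_n -> \bar R)
    (u : 'rV[R]_n -> \bar R) : Prop :=
  forall x : 'rV[R]_n,
    (forall xs : nat -> 'rV[R]_n, xs @ \oo --> x ->
        (u x <= limn_einf (fun k => uk k (xs k)))%E) /\
    (exists2 xs : nat -> 'rV[R]_n, xs @ \oo --> x &
        (limn_esup (fun k => uk k (xs k)) <= u x)%E).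

End Defs.

(* Main.v *)
(* Two facts describe epi-convergence of convex functions: a lower bound
   [c < u x] persists for [u_k], [k] large, uniformly near [x] ([epi_lower]), and
   an upper bound [u x < c] is attained by [u_k], [k] large, at points
   arbitrarily close to [x] ([epi_upper]).

   If delta tends to 0, then by Chebyshev no ball can carry a uniform gap between
   [zeta o u_k] and [zeta o u]. Every point [x] of the domain is approached by
   balls [(1 - t) x + t B], [B] inside the domain, on which convexity bounds [u];
   this yields [epi_upper], hence a uniform bound of the [u_k] on an interior
   ball, and the same cone construction applied to [u_k] yields [epi_lower].

   Conversely, compactness of spheres turns the two facts into a common cone bound
   [a |x| + b <= u_k x], so that zeta (a |x| + b) ^ p is an integrable majorant.
   Pointwise convergence holds off the boundary of the domain of [u], which is a
   null set: slicing a compact convex set [C] along the first coordinate, over an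
   interior point of the projection of [C] only the two ends of the slice can
   lie on the boundary of [C], and the rest is induction on the dimension.

   Definiteness of delta is the equivalence for a constant sequence. *)
Require Import Defs.
From HB Require Import structures.
From mathcomp Require Import all_boot all_order all_algebra.
From mathcomp Require Import all_classical all_reals all_analysis.
From mathcomp Require Import measurable_realfun ring lra.
Set Implicit Arguments. Unset Strict Implicit. Unset Printing Implicit Defensive.
Import Order.TTheory GRing.Theory Num.Theory.
Import numFieldNormedType.Exports.
Local Open Scope classical_set_scope.
Local Open Scope ring_scope.

(** * Lebesgue measure on row vectors *)

Section Rn_measurable.
Variable R : realType.

(** Generating the sigma-algebra by coordinate preimages makes measurability of a map into [Rn n] a
    coordinatewise matter; open sets are recovered in [open_measurable_Rn]. *)
Definition cylinders n : set (set 'rV[R]_n) :=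
  [set A | exists i : 'I_n, exists2 B : set (measurableTypeR R),
    measurable B & A = [set x : 'rV[R]_n | B (x ord0 i)]].

Definition Rn n := g_sigma_algebraType (@cylinders n).
HB.instance Definition _ n := Measurable.on (Rn n).

Lemma measurable_coord n (i : 'I_n) :
  measurable_fun [set: Rn n] (fun x : Rn n => (x : 'rV[R]_n) ord0 i : measurableTypeR R).
Proof.
move=> _ B mB; rewrite setTI; apply: sub_sigma_algebra.
by exists i, B.
Qed.

Lemma measurable_Rn d (T : measurableType d) n (f : T -> Rn n) :
  (forall i, measurable_fun [set: T]
    (fun t => (f t : 'rV[R]_n) ord0 i : measurableTypeR R)) ->
  measurable_fun [set: T] f.
Proof.
move=> mf; apply: (@measurability _ _ T (Rn n) setT f (@cylinders n) erefl).
move=> _ [_ [i [B mB ->]] <-].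
exact: (mf i measurableT B mB).
Qed.

Definition pair_row n (tx : measurableTypeR R * Rn n) : Rn n.+1 :=
  cons_row tx.1 (tx.2 : 'rV[R]_n).

Definition row_pair n (x : Rn n.+1) : measurableTypeR R * Rn n :=
  ((x : 'rV[R]_n.+1) ord0 ord0, \row_(j < n) (x : 'rV[R]_n.+1) ord0 (lift ord0 j)).

Lemma cons_row0 n (t : R) (x : 'rV[R]_n) : cons_row t x ord0 ord0 = t.
Proof. by rewrite mxE unlift_none. Qed.

Lemma cons_row_lift n (t : R) (x : 'rV[R]_n) i :
  cons_row t x ord0 (lift ord0 i) = x ord0 i.
Proof. by rewrite mxE liftK. Qed.

Lemma row_pairK n : cancel (@row_pair n) (@pair_row n).
Proof.
move=> x; apply/rowP => i; rewrite /pair_row /= mxE.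
by case: unliftP => [j ->|->] //; rewrite mxE.
Qed.

Lemma pair_rowK n : cancel (@pair_row n) (@row_pair n).
Proof.
move=> [t x]; rewrite /row_pair /pair_row /= cons_row0; congr pair.
by apply/rowP => i; rewrite mxE cons_row_lift.
Qed.

Lemma measurable_pair_row n : measurable_fun setT (@pair_row n).
Proof.
apply: measurable_Rn => i.
case: (unliftP ord0 i) => [j ->|->].
- rewrite (_ : (fun _ => _) = (fun tx : measurableTypeR R * Rn n => (tx.2 : 'rV[R]_n) ord0 j)); last first.
    by apply/funext => tx; rewrite /pair_row cons_row_lift.
  exact: (measurableT_comp (measurable_coord j) measurable_snd).
- rewrite (_ : (fun _ => _) = fst); first exact: measurable_fst.
  by apply/funext => tx; rewrite /pair_row cons_row0.
Qed.

Lemma measurable_row_pair n : measurable_fun setT (@row_pair n).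
Proof.
apply: measurable_fun_pair; first exact: measurable_coord.
apply: measurable_Rn => i; under eq_fun do rewrite mxE.
exact: measurable_coord.
Qed.

HB.instance Definition _ n := isMeasurableFun.Build _ _ _ _ _ (@measurable_pair_row n).
HB.instance Definition _ n := isMeasurableFun.Build _ _ _ _ _ (@measurable_row_pair n).

End Rn_measurable.

(** * Lebesgue measure by iterated products, and Tonelli *)

Section lebesgue_Rn.
Variable R : realType.

Section step.
Variables (n : nat) (m : {sigma_finite_measure set (Rn R n) -> \bar R}).

(** The first coordinate is split off exactly as in [integral_Rn], so that Tonelli reproduces the
    recursion of that fixpoint. *)
Definition lebesgue_Rn_step : set (Rn R n.+1) -> \bar R :=
  pushforward (@lebesgue_measure R \x m)%E (@pair_row R n).

Let lebesgue_Rn_step0 : lebesgue_Rn_step set0 = 0%E.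
Proof. by rewrite /lebesgue_Rn_step /pushforward preimage_set0 measure0. Qed.

Let lebesgue_Rn_step_ge0 A : (0 <= lebesgue_Rn_step A)%E.
Proof. exact: measure_ge0. Qed.

Let lebesgue_Rn_step_sigma_additive : semi_sigma_additive lebesgue_Rn_step.
Proof. exact: measure_semi_sigma_additive. Qed.

HB.instance Definition _ := isMeasure.Build _ _ _ lebesgue_Rn_step
  lebesgue_Rn_step0 lebesgue_Rn_step_ge0 lebesgue_Rn_step_sigma_additive.

Let lebesgue_Rn_step_sigma_finite : sigma_finite setT lebesgue_Rn_step.
Proof.
have /sigma_finiteP[F [TF ndF Foo]] := sigma_finiteT (@lebesgue_measure R).
have /sigma_finiteP[G [TG ndG Goo]] := sigma_finiteT m.
exists (fun k => @row_pair R n @^-1` (F k `*` G k)).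
  rewrite -preimage_bigcup (_ : \bigcup_k _ = setT) ?preimage_setT//.
  rewrite -subTset => -[x y] _.
  have [[k _ Fkx] [l _ Gly]] : (\bigcup_i F i) x /\ (\bigcup_i G i) y.
    by rewrite -TF -TG.
  (* Both exhaustions are nondecreasing, so one index serves both factors. *)
  exists (maxn k l) => //; split.
  - by move: x Fkx; exact/subsetPset/ndF/leq_maxl.
  - by move: y Gly; exact/subsetPset/ndG/leq_maxr.
move=> k; have [mF Fk] := Foo k; have [mG Gk] := Goo k; split.
  rewrite -[X in measurable X]setTI; apply: measurable_row_pair => //.
  exact: measurableX.
rewrite /lebesgue_Rn_step /pushforward -comp_preimage.
rewrite (_ : _ \o _ = id); last by apply/funext => x /=; rewrite pair_rowK.
by rewrite preimage_id product_measure1E// lte_mul_pinfty// ge0_fin_numE.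
Qed.

HB.instance Definition _ := Measure_isSigmaFinite.Build _ _ _ lebesgue_Rn_step
  lebesgue_Rn_step_sigma_finite.

Lemma integral_step (f : Rn R n.+1 -> \bar R) :
  measurable_fun [set: Rn R n.+1] f -> (forall x, 0 <= f x)%E ->
  (\int[lebesgue_Rn_step]_x f x =
   \int[m]_x \int[@lebesgue_measure R]_t f (pair_row (t, x)))%E.
Proof.
move=> mf f0; rewrite ge0_integral_pushforward// preimage_setT.
rewrite fubini_tonelli2//; last by move=> ?; exact: f0.
exact: (measurableT_comp mf (@measurable_pair_row R n)).
Qed.

End step.

Definition Rn0 : Rn R 0 := (0 : 'rV[R]_0).

Fixpoint lebesgue_Rn n : {sigma_finite_measure set (Rn R n) -> \bar R} :=
  match n with
  | 0 => [the {sigma_finite_measure set (Rn R 0) -> \bar R} of dirac Rn0]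
  | n'.+1 => [the {sigma_finite_measure set (Rn R n'.+1) -> \bar R} of lebesgue_Rn_step (lebesgue_Rn n')]
  end.

#[local] Arguments lebesgue_Rn : simpl never.

Lemma integral_lebesgue_RnS n (f : Rn R n.+1 -> \bar R) :
  measurable_fun [set: Rn R n.+1] f -> (forall x, 0 <= f x)%E ->
  (\int[lebesgue_Rn n.+1]_x f x =
   \int[lebesgue_Rn n]_x \int[@lebesgue_measure R]_t f (pair_row (t, x)))%E.
Proof. exact: integral_step. Qed.

Lemma measurable_integral_pair_row n (f : Rn R n.+1 -> \bar R) :
  measurable_fun [set: Rn R n.+1] f -> (forall x, 0 <= f x)%E ->
  measurable_fun setT
   (fun x : Rn R n => \int[@lebesgue_measure R]_t f (pair_row (t, x)))%E.
Proof.
move=> mf f0.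
apply: (@measurable_fun_fubini_tonelli_G _ _ _ _ _ (@lebesgue_measure R) (f \o @pair_row R n)); last by move=> ?; exact: f0.
exact: (measurableT_comp mf (@measurable_pair_row R n)).
Qed.

(** The bridge from the iterated integral in [delta] to integration against a measure: evaluation at
    0 is a Dirac mass, and each further dimension is one use of Tonelli. *)
Lemma integral_RnE n (f : Rn R n -> \bar R) :
  measurable_fun [set: Rn R n] f -> (forall x, 0 <= f x)%E ->
  integral_Rn f = (\int[lebesgue_Rn n]_x f x)%E.
Proof.
elim: n f => [f mf f0 /=|n IHn f mf f0].
  by rewrite integral_dirac// diracT mul1e.
rewrite integral_lebesgue_RnS// -IHn//.
  exact: measurable_integral_pair_row.
by move=> x; exact: integral_ge0.
Qed.

End lebesgue_Rn.
Arguments lebesgue_Rn : simpl never.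

(** * The sup norm on row vectors *)

Section norm_rV.
Variable R : realType.

(** The sign of [r] matters in dimension 0, where the right-hand side is vacuous. *)
Lemma rV_norm_leP n (x : 'rV[R]_n) (r : R) : 0 <= r ->
  (`|x| <= r) <-> (forall i, `|x ord0 i| <= r).
Proof.
move=> r0; rewrite [`|x|]/Num.norm /= mx_normrE; split.
  by move=> /bigmax_leP[_ +] i => /(_ (ord0, i)); apply.
by move=> xr; apply/bigmax_leP; split => // -[i j] _ /=; rewrite (ord1 i).
Qed.

Lemma rV_norm_ltP n (x : 'rV[R]_n) (r : R) : 0 < r ->
  (`|x| < r) <-> (forall i, `|x ord0 i| < r).
Proof.
move=> r0; rewrite [`|x|]/Num.norm /= mx_normrE; split.
  by move=> /bigmax_ltP[_ +] i => /(_ (ord0, i)); apply.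
by move=> xr; apply/bigmax_ltP; split => // -[i j] _ /=; rewrite (ord1 i).
Qed.

Lemma coord_le_norm n (x : 'rV[R]_n) i : `|x ord0 i| <= `|x|.
Proof. exact: (rV_norm_leP x (normr_ge0 x)).1. Qed.

Lemma norm_cons_row n (t : R) (x : 'rV[R]_n) :
  `|cons_row t x| = Num.max `|t| `|x|.
Proof.
apply/eqP; rewrite eq_le; apply/andP; split.
  apply/rV_norm_leP => [|i]; first by rewrite le_max normr_ge0.
  case: (unliftP ord0 i) => [j ->|->]; rewrite (cons_row0, cons_row_lift).
    by rewrite le_max coord_le_norm orbT.
  by rewrite le_max lexx.
rewrite ge_max; apply/andP; split.
  by rewrite -[t in leLHS](cons_row0 t x) coord_le_norm.
by apply/rV_norm_leP => // i; rewrite -[x ord0 i](cons_row_lift t x) coord_le_norm.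
Qed.

Lemma cons_rowB n (t s : R) (x y : 'rV[R]_n) :
  cons_row t x - cons_row s y = cons_row (t - s) (x - y).
Proof.
apply/rowP => i; rewrite !mxE; case: unliftP => [j _|_].
  by rewrite !mxE.
by [].
Qed.

Lemma cons_rowK n (x : 'rV[R]_n.+1) :
  cons_row (x ord0 ord0) (\row_(j < n) x ord0 (lift ord0 j)) = x.
Proof. exact: (@row_pairK R n). Qed.

Lemma ball_cons_row n (t s r : R) (x y : 'rV[R]_n) :
  ball (cons_row t x) r (cons_row s y) <-> ball t r s /\ ball x r y.
Proof.
rewrite -!ball_normE /ball_ /= cons_rowB norm_cons_row gt_max.
by split => [/andP//|[-> ->]].
Qed.

End norm_rV.

(** * Measurability of open sets, volume of balls *)

Section lebesgue_Rn_ball.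
Variable R : realType.

Lemma measurable_ball_Rn n (x : 'rV[R]_n) r : measurable (ball x r : set (Rn R n)).
Proof.
have [r0|r0] := ltP 0 r; last first.
  rewrite (_ : ball x r = set0) ?measurable0//.
  by rewrite -subset0 => y; rewrite -ball_normE /= => /(le_lt_trans (normr_ge0 _)); rewrite ltNge r0.
rewrite (_ : ball x r = \bigcap_(i in [set: 'I_n])
   ((fun y : Rn R n => (y : 'rV[R]_n) ord0 i) @^-1` ball (x ord0 i) r)).
  apply: fin_bigcap_measurable => // i _.
  rewrite -[X in measurable X]setTI; apply: measurable_coord => //.
  exact: measurable_ball.
rewrite -ball_normE /=; apply/seteqP; split => y /=.
  by move=> /rV_norm_ltP -/(_ r0) xy i _ /=; have := xy i; rewrite !mxE -ball_normE.
move=> xy; apply/rV_norm_ltP => // i.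
by have := xy i I; rewrite /= -ball_normE /= !mxE.
Qed.

Lemma rat_rV_near n (x : 'rV[R]_n) (e : R) : 0 < e ->
  exists q : 'rV[rat]_n, `|x - map_mx ratr q| < e.
Proof.
move=> e0.
have /choice[f fP] : forall i, exists q : rat, `|x ord0 i - ratr q| < e.
  move=> i; have [|q] := @rat_in_itvoo R (x ord0 i - e) (x ord0 i + e).
    by rewrite ltrBlDr -addrA ltrDl addr_gt0.
  by rewrite in_itv /= => qx; exists q; rewrite distrC ltr_distl.
exists (\row_i f i); apply/rV_norm_ltP => // i.
by rewrite !mxE.
Qed.

(** An open set is the union of the balls with rational centre and radius that it contains, a
    countable family. *)
Lemma open_measurable_Rn n (U : set 'rV[R]_n) : open U -> measurable (U : set (Rn R n)).
Proof.
move=> oU.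
pose B (qr : 'rV[rat]_n * rat) : set (Rn R n) :=
  ball (map_mx ratr qr.1 : 'rV[R]_n) (ratr qr.2).
rewrite (_ : U = \bigcup_qr (if `[< B qr `<=` U >] then B qr else set0)).
  apply: countable_bigcupT_measurable => [|qr]; first exact: countableP.
  by case: ifP => // _; exact: measurable_ball_Rn.
apply/seteqP; split => [x Ux|x [qr _]]; last by case: asboolP => // + ?; exact.
have [e /= e0 xeU] : nbhs_ball x U.
  by rewrite nbhs_ballE; exact: open_nbhs_nbhs.
have [r] := @rat_in_itvoo R 0 (e / 2) (divr_gt0 e0 (ltr0n _ 2)).
rewrite in_itv /= => /andP[r0 re].
have [q qx] := rat_rV_near x r0.
exists (q, r) => //=; rewrite asboolT.
  by rewrite /B -ball_normE /ball_ /= distrC.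
move=> y; rewrite /B -ball_normE /ball_ /= => qy; apply: xeU.
rewrite -ball_normE /ball_ /= (le_lt_trans (ler_distD (map_mx ratr q) _ _))//.
by rewrite (splitr e) ltrD// (lt_trans _ re).
Qed.

(** A ball of the sup norm is a cube of side [2 r], hence the product of an interval and a
    lower-dimensional cube. *)
Lemma lebesgue_Rn_ball n (x : 'rV[R]_n) r : 0 < r -> lebesgue_Rn R n (ball x r) = ((r *+ 2) ^+ n)%:E.
Proof.
elim: n x => [x r0|n IHn x r0].
  rewrite [LHS](_ : _ = (\1_(ball x r) (Rn0 R))%:E)// indicE mem_set ?expr0//.
  by rewrite (_ : Rn0 R = x); [exact: ballxx | apply/rowP => -[]].
rewrite [LHS](_ : _ = (@lebesgue_measure R \x lebesgue_Rn R n)%E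
  (ball (x ord0 ord0) r `*` ball (\row_(j < n) x ord0 (lift ord0 j)) r)).
  rewrite product_measure1E//; [|exact: measurable_ball|exact: measurable_ball_Rn].
  rewrite IHn// exprS EFinM; congr (_ * _)%E.
  exact: (lebesgue_measure_ball (x ord0 ord0) (ltW r0)).
rewrite /= /lebesgue_Rn_step /pushforward; congr product_measure1.
apply/seteqP; split => -[t y] /=.
  by rewrite /pair_row -{1}(cons_rowK x) => /ball_cons_row.
by move=> /ball_cons_row; rewrite cons_rowK.
Qed.

End lebesgue_Rn_ball.

(** * The boundary of a convex set is negligible *)

Section null_boundary.
Variable R : realType.

Definition is_convex n (S : set 'rV[R]_n) := forall x y t,
  S x -> S y -> 0 <= t <= 1 -> S ((1 - t) *: x + t *: y).

Lemma cons_row_comb n (a b t s : R) (x y : 'rV[R]_n) :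
  a *: cons_row t x + b *: cons_row s y = cons_row (a * t + b * s) (a *: x + b *: y).
Proof.
apply/rowP => i; rewrite !mxE; case: unliftP => [j _|_] //.
by rewrite !mxE.
Qed.

Definition tail_row n (x : 'rV[R]_n.+1) : 'rV[R]_n := \row_j x ord0 (lift ord0 j).

Lemma tail_cons_row n t (x : 'rV[R]_n) : tail_row (cons_row t x) = x.
Proof. by apply/rowP => i; rewrite mxE cons_row_lift. Qed.

Lemma norm_tail_row n (x : 'rV[R]_n.+1) : `|tail_row x| <= `|x|.
Proof. by rewrite -[x in leRHS]cons_rowK norm_cons_row le_max lexx orbT. Qed.

Lemma tail_row_continuous n : continuous (@tail_row n).
Proof.
move=> x; apply/(@cvgrPdist_lt _ _ _ (nbhs x)) => e e0; apply/nbhs_ballP; exists e => //= y.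
rewrite -ball_normE /= => xy.
rewrite (_ : _ - _ = tail_row (x - y)); last by apply/rowP => i; rewrite !mxE.
exact: le_lt_trans (norm_tail_row _) xy.
Qed.

Lemma is_convex_tail n (C : set 'rV[R]_n.+1) :
  is_convex C -> is_convex (@tail_row n @` C).
Proof.
move=> cC _ _ t [x Cx <-] [y Cy <-] t01.
exists ((1 - t) *: x + t *: y); first exact: cC.
by apply/rowP => i; rewrite !mxE.
Qed.

(* A point near [cons_row b x] is a convex combination of a point of the slice of
   [C] over [x], with weight [1 - s], and a point of [C] over [x + (y - x) / s],
   with weight [s]; the latter exists by the hypothesis on the projection. *)
Lemma interior_slice n (C : set 'rV[R]_n.+1) (M : R) (x : 'rV[R]_n) (r a b c : R) :
  is_convex C -> (forall z, C z -> `|z| <= M) ->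
  0 < r -> ball x r `<=` (@tail_row n @` C) ->
  C (cons_row a x) -> C (cons_row c x) -> a < b < c ->
  C° (cons_row b x).
Proof.
move=> cC CM r0 xrD Ca Cc /andP[ab bc].
have M0 : 0 <= M by apply: le_trans (CM _ Ca).
pose eta := Num.min (b - a) (c - b).
have eta0 : 0 < eta by rewrite lt_min !subr_gt0 ab.
pose k := `|b| + M + 1.
have k1 : 1 <= k by rewrite lerDr addr_ge0.
have k0 : 0 < k by apply: lt_le_trans k1.
(* [k] bounds [|b - t'|] for the height [t'] of any point of [C]. With this [s] and the [d] below,
   [|tau - b|] is at most [(eta / 4 + eta / 4) / (1 - s) <= eta], which keeps [tau] between [a] and
   [c]. *)
pose s := Num.min 2^-1 (eta / (4 * k)).
have s0 : 0 < s by rewrite lt_min invr_gt0 ltr0n divr_gt0// mulr_gt0.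
have s2 : s <= 2^-1 by rewrite ge_min lexx.
have sk : s * k <= eta / 4.
  rewrite -ler_pdivlMr// (le_trans (_ : _ <= eta / (4 * k)))//.
    by rewrite ge_min lexx orbT.
  by rewrite invfM mulrA.
pose d := Num.min (eta / 4) (s * r).
have d0 : 0 < d by rewrite lt_min divr_gt0//= mulr_gt0.
apply/nbhs_ballP; exists d => //= z.
rewrite -[z]cons_rowK => /ball_cons_row[]; set t := z _ _; set y := \row_j _.
rewrite -!ball_normE /= => bt xy.
pose y' := x + s^-1 *: (y - x).
have [w Cw wy'] : (@tail_row n @` C) y'.
  apply: xrD; rewrite -ball_normE /= /y' opprD addrA subrr add0r normrN normrZ.
  rewrite gtr0_norm ?invr_gt0// mulrC ltr_pdivrMr// distrC (lt_le_trans xy)//.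
  by rewrite /d ge_min (mulrC r) lexx orbT.
pose t' := w ord0 ord0.
have wE : w = cons_row t' y' by rewrite -wy' cons_rowK.
have t'M : `|t'| <= M by apply: le_trans (CM _ Cw); exact: coord_le_norm.
(* The solution of [(1 - s) * tau + s * t' = t]. *)
pose tau := (t - s * t') / (1 - s).
have s1 : 0 < 1 - s by rewrite subr_gt0 (le_lt_trans s2)// invf_lt1// ltr1n.
have taub : `|tau - b| <= eta.
  rewrite (_ : tau - b = (t - b + s * (b - t')) / (1 - s)); last first.
    by rewrite /tau; field; rewrite gt_eqF.
  rewrite normrM normfV (gtr0_norm s1) ler_pdivrMr//.
  rewrite (le_trans (ler_normD _ _))//.
  have : `|s * (b - t')| <= eta / 4.
    rewrite normrM gtr0_norm// (le_trans _ sk)// ler_pM2l//.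
    rewrite (le_trans (ler_normB _ _))// /k -addrA lerD2l.
    by rewrite (le_trans t'M)// lerDl.
  have : `|t - b| <= eta / 4.
    by rewrite distrC ltW// (lt_le_trans bt)// /d ge_min lexx.
  have := ler_wpM2l (ltW eta0) s2.
  lra.
have Ctau : C (cons_row tau x).
  have ac : 0 < c - a by rewrite subr_gt0 (lt_trans ab).
  have -> : cons_row tau x = (1 - (tau - a) / (c - a)) *: cons_row a x +
       ((tau - a) / (c - a)) *: cons_row c x.
    rewrite cons_row_comb -scalerDl subrK scale1r; congr cons_row.
    by field; rewrite gt_eqF.
  apply: cC => //; rewrite divr_ge0 ?ler_pdivrMr// ?(ltW ac)// ?mul1r.
    move: taub; rewrite ler_norml => /andP[_].
    have : eta <= c - b by rewrite ge_min lexx orbT.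
    lra.
  move: taub; rewrite ler_norml => /andP[].
  have : eta <= b - a by rewrite ge_min lexx.
  lra.
have -> : cons_row t y = (1 - s) *: cons_row tau x + s *: w.
  rewrite wE cons_row_comb; congr cons_row.
    by rewrite /tau; field; rewrite gt_eqF.
  rewrite /y' scalerDr scalerA divff ?gt_eqF// scale1r scalerBl scale1r.
  by rewrite addrA subrK addrC subrK.
by apply: cC => //; rewrite (ltW s0)/= (le_trans s2)// invf_le1// ler1n.
Qed.

(** Among three distinct reals one lies strictly between the others, so [S] has at most two
    elements. Countability is all that is needed to make it a null set. *)
Lemma countable_no3 (S : set R) :
  (forall a b c, S a -> S b -> S c -> ~ (a < b < c)) -> countable S.
Proof.
move=> S3.
have [S0|] := pselect (S = set0); first by rewrite S0; exact: countable0.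
move=> /eqP/set0P[a Sa].
have [Sa1|] := pselect (S `<=` [set a]).
  by apply: (sub_countable (subset_card_le Sa1)).
move=> /existsNP[b /not_implyP[Sb /= /eqP ab]].
apply: (@sub_countable _ _ _ [set a; b]); last first.
  exact/finite_set_countable/finite_set2.
apply: subset_card_le => c Sc /=.
apply: contrapT => /not_orP[/eqP ca /eqP cb].
move: ab ca cb; rewrite !neq_lt => /orP[] ab /orP[] ca /orP[] cb;
  by [ apply: (S3 _ _ _ Sa Sb Sc); apply/andP
     | apply: (S3 _ _ _ Sa Sc Sb); apply/andP
     | apply: (S3 _ _ _ Sb Sa Sc); apply/andP
     | apply: (S3 _ _ _ Sb Sc Sa); apply/andP
     | apply: (S3 _ _ _ Sc Sa Sb); apply/andP
     | apply: (S3 _ _ _ Sc Sb Sa); apply/andP ].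
Qed.

(** Induction on the dimension through Tonelli. Compactness gives the bound required by
    [interior_slice] and passes to the projection [D]. Over [D \ D°], null by induction, nothing is
    claimed; over any other [x] the slice is empty or [interior_slice] forbids three boundary points
    in it. *)
Lemma is_convex_boundary0 n (C : set 'rV[R]_n) :
  compact C -> is_convex C -> lebesgue_Rn R n (C `\` C°) = 0%E.
Proof.
elim: n C => [|n IHn] C cptC cC.
  rewrite (_ : _ `\` _ = set0) ?measure0// -subset0 => x [Cx]; apply.
  rewrite /interior (_ : C = setT); first exact: filterT.
  by rewrite -subTset => y _; rewrite (_ : y = x)//; apply/rowP => -[].
have clC m (K : set 'rV[R]_m) : compact K -> measurable (K `\` K° : set (Rn R m)).
  move=> cK; apply: measurableD.
    rewrite -(setCK K); apply: measurableC; apply: open_measurable_Rn.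
    by rewrite openC; apply: compact_closed cK; exact: norm_hausdorff.
  by apply: open_measurable_Rn; exact: open_interior.
have [M CM] : exists M, forall z, C z -> `|z| <= M.
  have [M [Mr MC]] := compact_bounded cptC.
  by exists (M + 1) => z Cz; apply: MC Cz; rewrite ltrDl.
pose D := @tail_row n @` C.
have cptD : compact D.
  by apply: continuous_compact cptC; apply: continuous_subspaceT; exact: tail_row_continuous.
have mB := clC _ _ cptC; have mD := clC _ _ cptD.
have mI : measurable_fun [set: Rn R n.+1] (fun x => (\1_(C `\` C°) x)%:E : \bar R).
  exact/measurable_EFinP/measurable_indic.
have I0 x : (0 <= (\1_(C `\` C°) x)%:E :> \bar R)%E by rewrite lee_fin.
rewrite -[C `\` _]setIT -integral_indic// integral_lebesgue_RnS//.
rewrite (@ge0_ae_eq_integral _ _ _ (lebesgue_Rn R n) setT _ (cst 0%E)) ?integral0//.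
- exact: (measurable_integral_pair_row mI I0).
- by move=> x _; apply: integral_ge0.
exists (D `\` D°); split => //; first exact: IHn cptD (is_convex_tail cC).
move=> x /= /not_implyP[_]; apply: contra_notP => DDx.
pose S : set (measurableTypeR R) := [set t | (C `\` C°) (cons_row t x)].
have mS : measurable S.
  have mx : measurable_fun [set: measurableTypeR R] (fun t => pair_row (t, x)).
    exact: (measurableT_comp (@measurable_pair_row R n) (pair2_measurable x)).
  by have := mx measurableT _ mB; rewrite setTI.
rewrite (_ : (fun t => _) = (fun t => (\1_S t)%:E)); last first.
  by apply/funext => t.
rewrite integral_indic// setIT; apply: countable_lebesgue_measure0.
apply: countable_no3 => a b c [Ca _] [Cb Cb'] [Cc _] abc; apply: Cb'.
have Dx : D x by exists (cons_row a x); rewrite ?tail_cons_row.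
have /nbhs_ballP[r /= r0 rD] : D° x by apply: contrapT => D'x; apply: DDx.
exact: (interior_slice cC CM r0 rD Ca Cc abc).
Qed.

End null_boundary.

(** * Integrability of radial functions *)

Section radial.
Variable R : realType.

Lemma lsc_measurable_Rn n (u : 'rV[R]_n -> \bar R) :
  lower_semicontinuous u -> measurable_fun setT (u : Rn R n -> \bar R).
Proof.
move=> lscu; apply: (measurability _ (ErealGenOInfty.measurableE R)).
move=> /= _ [_ [a ->]] <-; apply: measurableI => //; apply: open_measurable_Rn.
by rewrite preimage_itvoy; move/lower_semicontinuousP : lscu; exact.
Qed.

Lemma norm_measurable_Rn n :
  measurable_fun setT (fun x : Rn R n => `|x : 'rV[R]_n| : measurableTypeR R).
Proof.
apply: (measurability _ (RGenOInfty.measurableE R)).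
move=> /= _ [_ [a ->]] <-; apply: measurableI => //; apply: open_measurable_Rn.
apply: open_comp => // x _; exact: norm_continuous.
Qed.

(* The sup norm of [(t, x)] is [max |t| |x|]; the induction splits the integral at
   [|t| <= |x|]. *)
Lemma radial_integral_le n : exists2 C : R, 0 <= C &
  forall g : R -> R, measurable_fun setT g -> (forall t, 0 <= g t) ->
  (\int[lebesgue_Rn R n.+1]_x (g `|x : 'rV[R]_n.+1|)%:E <=
   C%:E * \int[@lebesgue_measure R]_(t in [set: measurableTypeR R])
     (g `|t : R| * `|t : R| ^+ n)%:E)%E.
Proof.
elim: n => [|n [C C0 IHn]].
  exists 1 => // g mg g0.
  have mgn : measurable_fun [set: Rn R 1]
      (fun x => (g `|x : 'rV[R]_1|)%:E : \bar R).
    apply/measurable_EFinP.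
    exact: (measurableT_comp mg (@norm_measurable_Rn 1)).
  rewrite integral_lebesgue_RnS//; last by move=> x; rewrite lee_fin.
  rewrite integral_dirac//; last first.
    by apply: (measurable_integral_pair_row mgn) => x; rewrite lee_fin.
  rewrite diracT !mul1e le_eqVlt; apply/orP; left; apply/eqP.
  apply: eq_integral => t _; rewrite /pair_row norm_cons_row expr0 mulr1.
  by rewrite normr0 max_l.
(* [2 * C] comes from the part [|t| <= |x|], where integrating in [t] gives a factor [2 |x|] before
   induction applies; [2 ^+ n.+1] comes from the volume of the ball of radius [|t|] over which [x]
   ranges in the other part. *)
pose D := 2 * C + 2 ^+ n.+1.
exists D => [|g mg g0]; first by rewrite addr_ge0 ?mulr_ge0 ?exprn_ge0.
have mnorm : measurable_fun [set: measurableTypeR R] (fun t : R => `|t|).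
  by apply: continuous_measurable_fun; exact: norm_continuous.
have mgn : measurable_fun [set: Rn R n.+2]
    (fun x => (g `|x : 'rV[R]_n.+2|)%:E : \bar R).
  apply/measurable_EFinP.
  exact: (measurableT_comp mg (@norm_measurable_Rn n.+2)).
rewrite integral_lebesgue_RnS//; last by move=> x; rewrite lee_fin.
pose S : set (measurableTypeR R * Rn R n.+1) :=
  [set tx | `|tx.1 : R| <= `|tx.2 : 'rV[R]_n.+1|].
have mfst : measurable_fun setT
    (fun tx : measurableTypeR R * Rn R n.+1 => `|tx.1 : R| : measurableTypeR R).
  exact: (measurableT_comp mnorm measurable_fst).
have msnd : measurable_fun setT
    (fun tx : measurableTypeR R * Rn R n.+1 => `|tx.2 : 'rV[R]_n.+1| : measurableTypeR R).
  exact: (measurableT_comp (@norm_measurable_Rn n.+1) measurable_snd).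
have mS : measurable S.
  by rewrite -[S]setTI; exact: measurable_fun_le.
pose f1 (tx : measurableTypeR R * Rn R n.+1) : \bar R :=
  ((g `|tx.2 : 'rV[R]_n.+1|)%:E * (\1_S tx)%:E)%E.
pose f2 (tx : measurableTypeR R * Rn R n.+1) : \bar R :=
  ((g `|tx.1 : R|)%:E * (\1_(~` S) tx)%:E)%E.
have f10 tx : (0 <= f1 tx)%E by rewrite mule_ge0// lee_fin.
have f20 tx : (0 <= f2 tx)%E by rewrite mule_ge0// lee_fin.
have mf1 : measurable_fun setT f1.
  apply: emeasurable_funM; apply/measurable_EFinP.
    exact: (measurableT_comp mg msnd).
  exact: measurable_indic.
have mf2 : measurable_fun setT f2.
  apply: emeasurable_funM; apply/measurable_EFinP.
    exact: (measurableT_comp mg mfst).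
  by apply: measurable_indic; exact: measurableC.
have SE (t : measurableTypeR R) (x : Rn R n.+1) :
    ((t, x) \in S) = (`|t : R| <= `|x : 'rV[R]_n.+1|).
  by apply/idP/idP; rewrite inE.
have gE (t : measurableTypeR R) (x : Rn R n.+1) :
    (g `|pair_row (t, x) : 'rV[R]_n.+2|)%:E = (f1 (t, x) + f2 (t, x))%E.
  rewrite /f1 /f2 -!EFinM -EFinD indicC !indicE SE norm_cons_row /=.
  by case: leP => tx; rewrite ?mulr1 ?mulr0 ?addr0 ?add0r.
under eq_integral => x _.
  under eq_integral do rewrite gE.
  rewrite ge0_integralD//; [|exact: measurable_fun_pair1..].
  over.
rewrite ge0_integralD//; last 4 first.
- by move=> x _; exact: integral_ge0.
- exact: (@measurable_fun_fubini_tonelli_G _ _ _ _ _ (@lebesgue_measure R) f1).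
- by move=> x _; exact: integral_ge0.
- exact: (@measurable_fun_fubini_tonelli_G _ _ _ _ _ (@lebesgue_measure R) f2).
pose h (t : R) := g `|t| * `|t| ^+ n.+1.
have mh : measurable_fun [set: R] h.
  apply: measurable_funM; first exact: measurableT_comp.
  exact: measurable_funX.
have h0 t : 0 <= h t by rewrite mulr_ge0 ?exprn_ge0.
have mEh : measurable_fun [set: measurableTypeR R] (fun t => (h t)%:E : \bar R).
  exact/measurable_EFinP.
(* The absolute value keeps [g'] nonnegative on the whole line, as the induction hypothesis asks. *)
pose g' r := g r * (2 * `|r|).
have I1 : (\int[lebesgue_Rn R n.+1]_x \int[@lebesgue_measure R]_t f1 (t, x) <=
           (2 * C)%:E * \int[@lebesgue_measure R]_t (h t)%:E)%E.
  under eq_integral => x _.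
    rewrite /f1 /= ge0_integralZl_EFin//=; last first.
      apply: (@measurable_fun_pair1 _ _ _ _ _ _ (fun tx => (\1_S tx)%:E) x).
      exact/measurable_EFinP/measurable_indic.
    rewrite (_ : \int[_]_t _ = (2 * `|x : 'rV[R]_n.+1|)%:E)%E; last first.
      transitivity (\int[@lebesgue_measure R]_t
          (\1_`[- `|x : 'rV[R]_n.+1|, `|x : 'rV[R]_n.+1|] t)%:E)%E.
        apply: eq_integral => t _; rewrite !indicE SE; congr (nat_of_bool _)%:R%:E.
        by apply/idP/idP; rewrite inE /= in_itv /= ler_norml.
      rewrite integral_indic// setIT; apply: etrans (lebesgue_measure_itv _) _.
      rewrite /= lte_fin.
      case: ltP => [_|]; first by rewrite opprK mulr2n mulrDl !mul1r.
      have := normr_ge0 (x : 'rV[R]_n.+1) => x0 x1.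
      by congr EFin; lra.
    rewrite -EFinM (_ : _ * _ = g' `|x : 'rV[R]_n.+1|); last by rewrite /g' normr_id.
    over.
  have mg' : measurable_fun [set: R] g'.
    apply: measurable_funM => //; apply: measurable_funM => //.
  apply: le_trans (IHn g' mg' _) _; first by move=> t; rewrite mulr_ge0// mulr_ge0.
  rewrite [X in (_ * X <= _)%E](_ : _ =
      2%:E * \int[@lebesgue_measure R]_t (h t)%:E)%E; last first.
    rewrite -ge0_integralZl_EFin//; last by move=> t _; rewrite lee_fin.
    apply: eq_integral => t _.
    rewrite -EFinM /g' /h normr_id exprS; congr EFin; ring.
  by rewrite muleA -EFinM mulrC.
have I2 : (\int[lebesgue_Rn R n.+1]_x \int[@lebesgue_measure R]_t f2 (t, x) =
           (2 ^+ n.+1)%:E * \int[@lebesgue_measure R]_t (h t)%:E)%E.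
  rewrite -(@fubini_tonelli _ _ _ _ _ (@lebesgue_measure R) (lebesgue_Rn R n.+1) f2)//.
  rewrite -ge0_integralZl_EFin ?exprn_ge0//; last by move=> t _; rewrite lee_fin.
  apply: eq_integral => t _.
  rewrite /f2 /= ge0_integralZl_EFin//=; last first.
    apply: (@measurable_fun_pair2 _ _ _ _ _ _ (fun tx => (\1_(~` S) tx)%:E) t).
    by apply/measurable_EFinP/measurable_indic; exact: measurableC.
  rewrite (_ : \int[_]_x _ = lebesgue_Rn R n.+1 (ball (0%R : 'rV[R]_n.+1) `|t : R|))%E; last first.
    rewrite -[ball _ _]setIT -integral_indic//; last exact: measurable_ball_Rn.
    apply: eq_integral => x _; rewrite !indicE; congr (nat_of_bool _)%:R%:E.
    apply/idP/idP; rewrite !inE -ball_normE /ball_ /= sub0r normrN /S /=.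
      by move=> /negP; rewrite -ltNge.
    by move=> tx; apply/negP; rewrite -ltNge.
  (* The volume formula for balls needs a positive radius; at [t = 0] both sides vanish. *)
  have [->|t0] := eqVneq (t : R) 0.
    rewrite normr0 (_ : ball _ _ = set0); last first.
      rewrite -subset0 => y; rewrite -ball_normE /= => y0.
      by have := le_lt_trans (normr_ge0 _) y0; rewrite ltxx.
    by rewrite measure0 mule0 /h normr0 expr0n !mulr0 mule0.
  rewrite lebesgue_Rn_ball ?normr_gt0// -!EFinM /h -[`|t : R| *+ 2]mulr_natl exprMn.
  by congr EFin; ring.
rewrite I2; apply: le_trans (leeD2r _ I1) _.
by rewrite -ge0_muleDl// lee_fin ?mulr_ge0// exprn_ge0.
Qed.

End radial.

(** * Integrability of a decreasing function of a cone *)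

Section cone_integrable.
Variable R : realType.

(** Evenness reduces the integral to the half-line, where the substitution of [c * t] only costs a
    factor [c ^- n.+1]. *)
Lemma integral_even_scaled_lty n (phi : R -> R) (c : R) :
  continuous phi -> (forall t, 0 <= phi t) -> 0 < c ->
  (\int[@lebesgue_measure R]_(t in `[0%R, +oo[) (phi t * t ^+ n)%:E < +oo)%E ->
  (\int[@lebesgue_measure R]_t (phi (c * `|t|) * `|t| ^+ n)%:E < +oo)%E.
Proof.
move=> cphi phi0 c0 Ioo.
have cX : continuous (fun t : R => t ^+ n) by move=> t; exact: exprn_continuous.
have cN : continuous (fun t : R => `|t|) by move=> t; exact: norm_continuous.
have cG : continuous (fun t => phi t * t ^+ n).
  by move=> t; apply: cvgM; [exact: cphi|exact: cX].
rewrite ge0_symfun_integralT; last 3 first.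
- by move=> t; rewrite mulr_ge0 ?exprn_ge0.
- move=> t; apply: cvgM.
    apply: (@continuous_comp _ _ _ (fun t : R => c * `|t|) phi); last exact: cphi.
    by apply: cvgM; [exact: cvg_cst|exact: cN].
  apply: (@continuous_comp _ _ _ (fun t : R => `|t|) (fun t : R => t ^+ n)); first exact: cN.
  exact: cX.
- by move=> t /=; rewrite normrN.
rewrite lte_mul_pinfty//.
rewrite -set_itvcy.
have FE : derive1 (fun t : R => c * t) = cst c.
  apply/funext => t; rewrite derive1E.
  by rewrite deriveM// derive_cst derive_id scaler0 addr0 /GRing.scale /= mulr1.
have := @increasing_ge0_integration_by_substitutiony R (fun t => c * t)
  (fun t => phi t * t ^+ n) 0.
rewrite FE mulr0 => H; move: Ioo; rewrite {}H; last 8 first.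
- by move=> x y _ _ xy; rewrite ltr_pM2l.
- by move=> x _; exact: cst_continuous.
- exact: is_cvg_cst.
- exact: is_cvg_cst.
- split; first by move=> x _; exact: derivableM.
  apply: cvg_at_right_filter; exact: mulrl_continuous.
- apply: gt0_cvgMry => //; exact: cvg_id.
- exact: continuous_subspaceT.
- by move=> x; rewrite in_itv /= andbT => /ltW x0; rewrite mulr_ge0 ?exprn_ge0.
move=> Ioo.
have cn0 : c ^- n.+1 * c ^+ n.+1 = 1 by rewrite mulVf// expf_neq0// gt_eqF.
pose F (t : R) := phi (c * t) * (c * t) ^+ n * c.
have {}Ioo : (\int[@lebesgue_measure R]_(t in `[0%R, +oo[) (F t)%:E < +oo)%E.
  exact: Ioo.
have F0 t : `[0, +oo[%classic t -> (0 <= (F t)%:E)%E.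
  rewrite /= in_itv /= andbT => t0; rewrite lee_fin !mulr_ge0// ?exprn_ge0//.
    by rewrite mulr_ge0// ltW.
  exact: ltW.
have mF : measurable_fun [set: R] F.
  apply: continuous_measurable_fun => t; apply: cvgM; last exact: cvg_cst.
  apply: (@continuous_comp _ _ _ (fun t : R => c * t) (fun x => phi x * x ^+ n)); last exact: cG.
  exact: mulrl_continuous.
rewrite [X in (X < _)%E](_ : _ = (c ^- n.+1)%:E *
    \int[@lebesgue_measure R]_(t in `[0%R, +oo[) (F t)%:E)%E.
  by rewrite lte_mul_pinfty// lee_fin invr_ge0 exprn_ge0// ltW.
rewrite -ge0_integralZl_EFin//; first last.
- by rewrite invr_ge0 exprn_ge0// ltW.
- by apply/measurable_EFinP/measurable_funTS.
apply: eq_integral => t; rewrite inE /= in_itv /= andbT => t0.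
rewrite -EFinM (ger0_norm t0); congr EFin; rewrite /F exprMn.
rewrite -[LHS]mul1r -cn0 exprS; ring.
Qed.

(** The shift [b], possibly negative, is absorbed by halving the slope outside [[-T, T]]; inside,
    the constant [K] dominates. *)
Lemma integral_cone_lty n (phi : R -> R) (a b : R) :
  continuous phi -> (forall t, 0 <= phi t) ->
  (forall s t, s <= t -> phi t <= phi s) -> 0 < a ->
  (\int[@lebesgue_measure R]_(t in `[0%R, +oo[) (phi t * t ^+ n)%:E < +oo)%E ->
  (\int[@lebesgue_measure R]_t (phi (a * `|t| + b) * `|t| ^+ n)%:E < +oo)%E.
Proof.
move=> cphi phi0 dphi a0 Ioo.
have mphi (c d : R) : measurable_fun [set: R] (fun t => phi (c * `|t| + d) * `|t| ^+ n).
  apply: measurable_funM.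
    apply: (measurableT_comp (continuous_measurable_fun cphi)).
    apply: measurable_funD => //; apply: measurable_funM => //.
  apply: measurable_funX.
  by apply: continuous_measurable_fun => t; exact: norm_continuous.
have m0 : measurable_fun [set: R] (fun t => (phi (a * `|t| + b) * `|t| ^+ n)%:E : \bar R).
  by apply/measurable_EFinP; exact: mphi.
(* beyond [T], [a |t| + b >= a |t| / 2] *)
pose T : R := 2 * `|b| / a.
have T0 : 0 <= T by rewrite divr_ge0 ?mulr_ge0// ltW.
pose K := phi b * T ^+ n.
have K0 : 0 <= K by rewrite mulr_ge0 ?exprn_ge0.
have m1 : measurable_fun [set: R] (fun t => (K%:E * (\1_`[- T, T] t)%:E)%E : \bar R).
  by apply: measurable_funeM; exact/measurable_EFinP/measurable_indic.
have m2 : measurable_fun [set: R] (fun t => (phi (a / 2 * `|t|) * `|t| ^+ n)%:E : \bar R).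
  by apply/measurable_EFinP; have := mphi (a / 2) 0; under eq_fun do rewrite addr0.
apply: (@le_lt_trans _ _ (\int[@lebesgue_measure R]_t
    (K%:E * (\1_`[(- T)%R, T] t)%:E + (phi (a / 2 * `|t|) * `|t| ^+ n)%:E))%E).
  apply: ge0_le_integral => //.
  - by move=> t _; rewrite lee_fin; apply: mulr_ge0; [exact: phi0|exact: exprn_ge0].
  - exact (emeasurable_funD m1 m2).
  move=> t _; rewrite -EFinM -EFinD lee_fin.
  have [tT|tT] := leP `|t| T.
    rewrite indicE mem_set /= ?in_itv /= -?ler_norml// mulr1.
    rewrite (@le_trans _ _ K)//; last by rewrite lerDl mulr_ge0 ?exprn_ge0.
    apply: ler_pM => //; rewrite ?exprn_ge0//; last exact: lerXn2r.
    by apply: dphi; rewrite lerDr mulr_ge0// ltW.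
  rewrite (@le_trans _ _ (phi (a / 2 * `|t|) * `|t| ^+ n))//; last first.
    by rewrite lerDr mulr_ge0.
  apply: ler_wpM2r; first exact: exprn_ge0.
  apply: dphi; move: tT; rewrite /T ltr_pdivrMr// => tT.
  have := ler_norm (- b); rewrite normrN; lra.
rewrite ge0_integralD//; first last.
- by move=> t _; rewrite lee_fin mulr_ge0 ?exprn_ge0.
- by move=> t _; rewrite -EFinM lee_fin mulr_ge0.
rewrite lte_add_pinfty//; last first.
  by apply: integral_even_scaled_lty Ioo => //; rewrite divr_gt0.
rewrite ge0_integralZl_EFin//; last exact/measurable_EFinP/measurable_indic.
rewrite lte_mul_pinfty// integral_indic// setIT.
by rewrite [X in (X < _)%E](lebesgue_measure_itv _); case: ifP => //; rewrite ltry.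
Qed.

Lemma integral_cone_Rn_lty n (phi : R -> R) (a b : R) :
  continuous phi -> (forall t, 0 <= phi t) ->
  (forall s t, s <= t -> phi t <= phi s) -> 0 < a ->
  (\int[@lebesgue_measure R]_(t in `[0%R, +oo[) (phi t * t ^+ n.-1)%:E < +oo)%E ->
  (\int[lebesgue_Rn R n]_x (phi (a * `|x : 'rV[R]_n| + b))%:E < +oo)%E.
Proof.
move=> cphi phi0 dphi a0 Ioo.
have mg : measurable_fun [set: R] (fun r => phi (a * r + b)).
  apply: (measurableT_comp (continuous_measurable_fun cphi)).
  by apply: measurable_funD => //; exact: measurable_funM.
(* The radial estimate starts in dimension 1; in dimension 0 the integral is a single value. *)
case: n Ioo => [_|n /= Ioo].
  rewrite integral_dirac ?diracT ?mul1e ?ltry//.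
  by apply/measurable_EFinP; exact: (measurableT_comp mg (@norm_measurable_Rn R 0)).
have [C C0 /(_ _ mg (fun t => phi0 _))] := radial_integral_le R n.
move/le_lt_trans; apply; apply: lte_mul_pinfty => //.
exact: integral_cone_lty Ioo.
Qed.

End cone_integrable.

(** * Epi-convergence *)

Section limsup.
Variable R : realType.
Implicit Types (u : nat -> \bar R) (c : \bar R).

Lemma limn_esup_le_near u c :
  (\forall k \near \oo, (u k <= c)%E) -> (limn_esup u <= c)%E.
Proof.
move=> uc; apply: (@le_trans _ _ (ereal_sup (u @` [set k | (u k <= c)%E]))).
  by apply: ereal_inf_lbound; exists [set k | (u k <= c)%E].
by apply: ge_ereal_sup => _ [k /= ukc <-].
Qed.

Lemma limn_esup_lt_near u c :
  (limn_esup u < c)%E -> \forall k \near \oo, (u k < c)%E.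
Proof.
move=> /ereal_inf_lt[_ [V FV <-] Vc].
apply: filterS FV => k Vk; apply: le_lt_trans Vc.
by apply: ereal_sup_ubound; exists k.
Qed.

Lemma limn_einf_ge_near u c :
  (\forall k \near \oo, (c <= u k)%E) -> (c <= limn_einf u)%E.
Proof.
move=> uc; rewrite /limn_einf leeNr; apply: limn_esup_le_near.
by apply: filterS uc => k; rewrite leeN2.
Qed.

Lemma limn_einf_gt_near u c :
  (c < limn_einf u)%E -> \forall k \near \oo, (c < u k)%E.
Proof.
rewrite /limn_einf lteNr => /limn_esup_lt_near.
by apply: filterS => k; rewrite lteN2.
Qed.

Lemma ereal_real_between (x y : \bar R) : (x < y)%E ->
  exists c : R, (x < c%:E)%E /\ (c%:E < y)%E.
Proof.
case: x y => [x| |] [y| |] //= xy.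
- exists ((x + y) / 2); rewrite !lte_fin; move: xy; rewrite lte_fin => xy.
  by split; lra.
- by exists (x + 1); rewrite lte_fin ltrDl ltry.
- by exists (y - 1); rewrite lte_fin ltrBlDr ltrDl ltNyr.
- by exists 0; rewrite ltry ltNyr.
Qed.

End limsup.

(** * Reformulation of epi-convergence by neighbourhoods *)

Section epi.
Variables (R : realType) (n : nat).
Implicit Types (uk : nat -> 'rV[R]_n -> \bar R) (u : 'rV[R]_n -> \bar R).

Definition epi_lower uk u := forall x (c : R), (c%:E < u x)%E ->
  exists2 r : R, 0 < r & \forall k \near \oo,
    forall y, ball x r y -> (c%:E < uk k y)%E.

Definition epi_upper uk u := forall x (c r : R), (u x < c%:E)%E -> 0 < r ->
  \forall k \near \oo, exists2 y, ball x r y & (uk k y < c%:E)%E.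

(** If the uniform bound fails, there are indices [k_m >= m] and points within [1 / (m + 1)] of [x]
    where [uk] is at most [c]. Arranged into one sequence converging to [x], they contradict the
    liminf inequality. *)
Lemma epi_liminf_lower uk u (x : 'rV[R]_n) (c : R) :
  (forall xs : nat -> 'rV[R]_n, xs @ \oo --> x ->
    (u x <= limn_einf (fun k => uk k (xs k)))%E) ->
  (c%:E < u x)%E ->
  exists2 r : R, 0 < r & \forall k \near \oo,
    forall y, ball x r y -> (c%:E < uk k y)%E.
Proof.
move=> liminf cux; apply: contrapT => nlow.
have /choice[f fP] : forall m : nat, exists ky : nat * 'rV[R]_n,
    [/\ (m <= ky.1)%N, ball x m.+1%:R^-1 ky.2 & (uk ky.1 ky.2 <= c%:E)%E].
  move=> m; apply: contrapT => nky; apply: nlow.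
  exists m.+1%:R^-1; first by rewrite invr_gt0.
  exists m => // k /= mk y xy; rewrite ltNge; apply/negP => ukc.
  by apply: nky; exists (k, y).
(* The chosen indices may repeat and need not increase: [xs k] is some chosen point of index [k], or
   [x] when there is none. *)
have /choice[xs xsP] : forall k, exists y,
    (forall m, (f m).1 = k -> exists2 m', (f m').1 = k & y = (f m').2) /\
    ((forall m, (f m).1 <> k) -> y = x).
  move=> k; have [[m fmk]|nm] := pselect (exists m, (f m).1 = k).
    exists (f m).2; split => [m' _|/(_ m)//]; by exists m.
  by exists x; split => // m fmk; case: nm; exists m.
have xsx : xs @ \oo --> x.
  apply/cvgrPdist_lt => e e0.
  have [M _ Me] := near_infty_natSinv_lt (PosNum e0).
  (* Strictly beyond every index used by some [m < M], a chosen point stems from [m' >= M] and is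
     therefore close to [x]. *)
  exists (\max_(m < M) (f m).1).+1 => // k /= Mk.
  have [[m fmk]|nm] := pselect (exists m, (f m).1 = k); last first.
    rewrite (xsP k).2 ?subrr ?normr0// => m fmk; apply: nm; by exists m.
  have [m' fm'k ->] := (xsP k).1 m fmk.
  have [_ + _] := fP m'; rewrite -ball_normE /= => /lt_trans; apply.
  apply: Me => /=; rewrite leqNgt; apply/negP => m'M.
  move: Mk; rewrite -fm'k ltnNge => /negP; apply.
  exact: (leq_bigmax (Ordinal m'M)).
have [N _ Nc] := limn_einf_gt_near (lt_le_trans cux (liminf _ xsx)).
have [Nf _ _] := fP N.
have [m' fm' xsE] := (xsP (f N).1).1 N erefl.
have := Nc _ Nf; rewrite xsE -fm'; have [_ _] := fP m'.
by rewrite ltNge => ->.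
Qed.

Lemma epi_convergesP uk u : (forall x, u x != -oo%E) ->
  epi_converges uk u <-> epi_lower uk u /\ epi_upper uk u.
Proof.
move=> uNy; split => [epi|[low up] x].
  split => [x c|x c r uxc r0]; first exact/epi_liminf_lower/(epi x).1.
  have [xs xsx uxs] := (epi x).2.
  have := limn_esup_lt_near (le_lt_trans uxs uxc).
  move/cvgrPdist_lt : xsx => /(_ _ r0); apply: filterS2 => k ukc xxs.
  by exists (xs k) => //; rewrite -ball_normE.
split.
  move=> xs xsx; rewrite leNgt; apply/negP => /ereal_real_between[c [Lc cux]].
  have [r r0 rc] := low x c cux.
  suff : (c%:E <= limn_einf (fun k => uk k (xs k)))%E by rewrite leNgt Lc.
  apply: limn_einf_ge_near; move/cvgrPdist_lt : xsx => /(_ _ r0).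
  by apply: filterS2 rc => k kc xxs; apply/ltW/kc; rewrite -ball_normE.
have [uxy|uxy] := eqVneq (u x) +oo%E.
  by exists (fun=> x); [exact: cvg_cst|rewrite uxy leey].
have uxE : u x = (fine (u x))%:E by rewrite fineK// fin_numE uNy.
set a := fine (u x) in uxE.
pose good m y k := ball x m.+1%:R^-1 y /\ (uk k y < (a + m.+1%:R^-1)%:E)%E.
have good_le m m' y k : (m' <= m)%N -> good m y k -> good m' y k.
  move=> mm'; have inv_le : m.+1%:R^-1 <= m'.+1%:R^-1 :> R.
    by rewrite lef_pV2 ?posrE// ler_nat.
  move=> [xy uky]; split; first exact: le_ball xy.
  by rewrite (lt_le_trans uky)// lee_fin lerD2l.
(* Diagonal choice of a recovery sequence: at index [k], take a point that is good for the largest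
   possible [m <= k]; by [good_le] it is good for all smaller [m]. *)
have /choice[xs xsP] : forall k, exists y, forall m, (m <= k)%N ->
    (exists z, good m z k) -> good m y k.
  move=> k; suff : forall b, exists y, forall m, (m <= b)%N ->
    (exists z, good m z k) -> good m y k by [].
  elim=> [|b [y IHb]].
    have [[z gz]|nz] := pselect (exists z, good 0 z k).
      by exists z => m; rewrite leqn0 => /eqP -> _.
    by exists x => m; rewrite leqn0 => /eqP -> gz; case: nz.
  have [[z gz]|nz] := pselect (exists z, good b.+1 z k).
    by exists z => m mb _; exact: good_le gz.
  exists y => m; rewrite leq_eqVlt => /orP[/eqP -> gz|mb]; [by case: nz|exact: IHb].
have near_good m : \forall k \near \oo, good m (xs k) k.
  have ma : (u x < (a + m.+1%:R^-1)%:E)%E by rewrite uxE lte_fin ltrDl invr_gt0.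
  have m0 : (0 : R) < m.+1%:R^-1 by rewrite invr_gt0.
  have := up x _ _ ma m0; apply: filterS2 (nbhs_infty_ge m) => k mk [y xy uky].
  by apply: xsP => //; exists y.
exists xs.
  apply/cvgrPdist_lt => e e0.
  have [M _ Me] := near_infty_natSinv_lt (PosNum e0).
  apply: filterS (near_good M) => k [+ _]; rewrite -ball_normE /= => /lt_trans; apply.
  exact: (Me M (leqnn M)).
rewrite uxE; apply/lee_addgt0Pr => e e0.
have [M _ Me] := near_infty_natSinv_lt (PosNum e0).
apply: limn_esup_le_near; apply: filterS (near_good M) => k [_ /ltW/le_trans]; apply.
by rewrite -EFinD lee_fin lerD2l ltW//; exact: (Me M (leqnn M)).
Qed.

End epi.

(** * Convex sets and convex functions *)

Section convex.
Variable R : realType.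

Lemma is_convex_sum n (S : set 'rV[R]_n) m (p : 'I_m.+1 -> 'rV[R]_n)
    (l : 'I_m.+1 -> R) :
  is_convex S -> (forall i, S (p i)) -> (forall i, 0 <= l i) ->
  \sum_i l i = 1 -> S (\sum_i l i *: p i).
Proof.
move=> cS; elim: m p l => [|m IHm] p l Sp l0.
  by rewrite !big_ord_recl !big_ord0 !addr0 => ->; rewrite scale1r.
rewrite !(big_ord_recl m.+1) /=; set w := \sum_(i < m.+1) l _ => lw.
have w0 : 0 <= w by apply: sumr_ge0.
(* The remaining weights are renormalised by their sum [w]; if [w = 0], they all vanish. *)
have [wE|wN0] := eqVneq w 0.
  rewrite big1 ?addr0; last first.
    move=> i _; suff -> : l (lift ord0 i) = 0 by rewrite scale0r.
    by have /psumr_eq0P : \sum_(i < m.+1) l (lift ord0 i) = 0 by []; exact.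
  by move: lw; rewrite wE addr0 => ->; rewrite scale1r.
rewrite (_ : l ord0 = 1 - w); last by rewrite -lw addrK.
rewrite (_ : \sum_(i < m.+1) _ = w *: \sum_(i < m.+1) (l (lift ord0 i) / w) *: p (lift ord0 i)).
  apply: cS => //; last by rewrite w0 /= -lw lerDr.
  apply: IHm => // [i|]; first by rewrite divr_ge0.
  by rewrite -mulr_suml divff.
rewrite scaler_sumr; apply: eq_bigr => i _.
by rewrite scalerA mulrCA divff// mulr1.
Qed.

(** The barycentre of the simplex is interior: its barycentric coordinates all equal [1 / (n + 1)],
    and they depend continuously on the point, so they stay nonnegative nearby. *)
Lemma simplex_interior n (S : set 'rV[R]_n) (pts : 'I_n.+1 -> 'rV[R]_n) :
  is_convex S -> (forall i, S (pts i)) -> affinely_independent pts ->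
  exists x, S° x.
Proof.
move=> cS Spts; rewrite /affinely_independent.
set A := \matrix_(i, j) _ => detA.
have Au : A \in unitmx by rewrite unitmxE unitfE.
pose e : 'rV[R]_n := const_mx n.+1%:R^-1.
exists (pts ord0 + e *m A).
pose B := invmx A.
(* A Lipschitz constant for the coordinates, from the sup norm to the sum of absolute values; the
   added 1 keeps it positive in dimension 0. *)
pose K := 1 + \sum_i \sum_j `|B j i|.
have K0 : 0 < K by rewrite ltr_pwDl// sumr_ge0// => i _; rewrite sumr_ge0.
apply/nbhs_ballP; exists (n.+1%:R^-1 / K) => /=; first by rewrite divr_gt0// invr_gt0.
move=> x; rewrite -ball_normE /= => xd.
pose c := (x - pts ord0) *m B.
have cA : c *m A = x - pts ord0 by rewrite mulmxKV.
(* The sum norm controls each coordinate and also the remaining one, [1 - \sum_j c ord0 j]. *)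
have ce : \sum_i `|c ord0 i - e ord0 i| < n.+1%:R^-1.
  have -> : n.+1%:R^-1 = n.+1%:R^-1 / K * K by rewrite divfK// gt_eqF.
  apply: (@le_lt_trans _ _ (`|x - (pts ord0 + e *m A)| * \sum_i \sum_j `|B j i|)).
    rewrite mulr_sumr; apply: ler_sum => i _.
    have -> : c ord0 i - e ord0 i = ((x - (pts ord0 + e *m A)) *m B) ord0 i.
      by rewrite opprD addrA mulmxBl mulmxK// !mxE.
    rewrite mxE (le_trans (ler_norm_sum _ _ _))// mulr_sumr.
    by apply: ler_sum => j _; rewrite normrM ler_wpM2r// coord_le_norm.
  apply: (@le_lt_trans _ _ (`|x - (pts ord0 + e *m A)| * K)).
    by rewrite ler_wpM2l// /K lerDr.
  by rewrite ltr_pM2r// distrC.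
have eE i : e ord0 i = n.+1%:R^-1 by rewrite mxE.
have c0 i : 0 <= c ord0 i.
  have : `|c ord0 i - e ord0 i| < n.+1%:R^-1.
    apply: le_lt_trans ce; rewrite (bigD1 i)//= lerDl; exact: sumr_ge0.
  by rewrite eE ltr_norml ltrBrDl subrr => /andP[/ltW].
have c1 : \sum_i c ord0 i <= 1.
  have -> : \sum_i c ord0 i = \sum_i (c ord0 i - e ord0 i) + n%:R / n.+1%:R.
    rewrite sumrB (eq_bigr (fun=> n.+1%:R^-1) (fun i _ => eE i)).
    by rewrite sumr_const card_ord -[X in _ = _ - X + _]mulr_natl subrK.
  have : \sum_i (c ord0 i - e ord0 i) <= n.+1%:R^-1.
    apply: le_trans (ltW ce); apply: ler_sum => i _; exact: ler_norm.
  move=> ce1; apply: (@le_trans _ _ (n.+1%:R^-1 + n%:R / n.+1%:R)); first by rewrite lerD2r.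
  by rewrite -[X in X + _]mul1r -mulrDl nat1r divff// pnatr_eq0.
pose l (i : 'I_n.+1) := match unlift ord0 i with
  | Some j => c ord0 j | None => 1 - \sum_j c ord0 j end.
have lS i : l (lift ord0 i) = c ord0 i by rewrite /l liftK.
have l0 : l ord0 = 1 - \sum_j c ord0 j by rewrite /l unlift_none.
have -> : x = \sum_i l i *: pts i.
  rewrite big_ord_recl l0 (eq_bigr (fun i => c ord0 i *: pts (lift ord0 i))); last first.
    by move=> i _; rewrite lS.
  have : x = pts ord0 + c *m A by rewrite cA addrC subrK.
  rewrite mulmx_sum_row => {1}->.
  rewrite scalerBl scale1r -addrA; congr (_ + _).
  rewrite scaler_suml -sumrN -big_split /=; apply: eq_bigr => i _.
  by rewrite addrC -scalerBr; congr (_ *: _); apply/rowP => j; rewrite !mxE.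
apply: is_convex_sum => //.
  move=> i; case: (unliftP ord0 i) => [j ->|->]; rewrite ?lS//.
  by rewrite l0 subr_ge0.
rewrite big_ord_recl (eq_bigr (fun i => c ord0 i)); last by move=> i _; rewrite lS.
by rewrite l0 subrK.
Qed.

(* Slicing [S] at the first coordinate of [q] preserves the hypothesis in one
   dimension less. *)
Lemma orthant_hull n (S : set 'rV[R]_n) (rho : R) (q : 'rV[R]_n) :
  is_convex S -> 0 < rho -> `|q| <= rho ->
  (forall s : 'I_n -> bool, exists2 y, S y &
     forall i, if s i then rho <= y ord0 i else y ord0 i <= - rho) ->
  S q.
Proof.
move=> + rho0; elim: n S q => [|n IHn] S q cS qrho SP.
  have [y Sy _] := SP (fun=> true).
  by rewrite (_ : q = y)//; apply/rowP => -[].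
rewrite -(cons_rowK q); set t := q _ _; set q' := \row_j _.
have : `|cons_row t q'| <= rho by rewrite cons_rowK.
rewrite norm_cons_row ge_max ler_norml => /andP[/andP[rt tr] q'rho].
apply: (IHn [set z | S (cons_row t z)]) => //.
  move=> x y l Sx Sy l01; rewrite /= (_ : t = (1 - l) * t + l * t).
    by rewrite -cons_row_comb; exact: cS.
  by rewrite -mulrDl subrK mul1r.
move=> s.
(* For a sign pattern [s] on the other coordinates, [y] and [z] lie on opposite sides in the first
   one; the weight [l] puts their combination at height [t]. *)
pose s' b (i : 'I_n.+1) := if unlift ord0 i is Some j then s j else b.
have [y Sy yP] := SP (s' true); have [z Sz zP] := SP (s' false).
have y0 : rho <= y ord0 ord0 by have := yP ord0; rewrite /s' unlift_none.
have z0 : z ord0 ord0 <= - rho by have := zP ord0; rewrite /s' unlift_none.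
pose l := (t - z ord0 ord0) / (y ord0 ord0 - z ord0 ord0).
have yz : 0 < y ord0 ord0 - z ord0 ord0 by rewrite subr_gt0; lra.
have l01 : 0 <= l <= 1.
  by rewrite divr_ge0 ?(ltW yz)//= ?subr_ge0 ?ler_pdivrMr// ?mul1r; lra.
pose w := (1 - l) *: z + l *: y.
have w0 : w ord0 ord0 = t by rewrite !mxE /l; field; rewrite gt_eqF.
exists (tail_row w); first by rewrite /= -w0 cons_rowK; exact: cS.
move=> i; rewrite !mxE; move: (yP (lift ord0 i)) (zP (lift ord0 i)).
rewrite /s' liftK; case/andP: l01 => l0 l1; case: (s i) => yi zi; nra.
Qed.

End convex.

(** * Uniform bounds for epi-convergent convex functions *)

Section convex_functions.
Variables (R : realType) (n : nat).
Implicit Types (uk : nat -> 'rV[R]_n -> \bar R) (u : 'rV[R]_n -> \bar R).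

Lemma ext_convex_le u x y t (a b : R) : ext_convex u -> 0 <= t <= 1 ->
  (u x <= a%:E)%E -> (u y <= b%:E)%E ->
  (u ((1 - t) *: x + t *: y)%R <= ((1 - t) * a + t * b)%:E)%E.
Proof.
move=> cu t01 ua ub; apply: le_trans (cu x y t t01) _.
case/andP: t01 => t0 t1.
by rewrite [leRHS]EFinD !EFinM leeD// lee_wpmul2l// lee_fin subr_ge0.
Qed.

Lemma is_convex_sublevel u (c : R) : ext_convex u -> is_convex [set x | (u x <= c%:E)%E].
Proof.
move=> cu x y t ux uy t01; apply: le_trans (ext_convex_le cu t01 ux uy) _.
by rewrite -mulrDl subrK mul1r.
Qed.

Lemma dom_lt_fin u x : u x != +oo%E -> exists a : R, (u x < a%:E)%E.
Proof.
case: (u x) => [r| |] // _; first by exists (r + 1); rewrite lte_fin ltrDl.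
by exists 0; rewrite ltNyr.
Qed.

Lemma is_convex_dom u : ext_convex u -> is_convex (dom u).
Proof.
move=> cu x y t /dom_lt_fin[a /ltW ux] /dom_lt_fin[b /ltW uy] t01.
by rewrite /dom /= -ltey (le_lt_trans (ext_convex_le cu t01 ux uy))// ltry.
Qed.

(** Serves to move a point slightly towards a region where a function is at most [M]: the value, at
    most [c'] before, stays below [c], since [t * |M - c'| <= (c - c') / 2]. *)
Lemma small_weight (c' c M e : R) : c' < c -> 0 < e ->
  exists2 t, 0 < t < 1 & t < e /\ (1 - t) * c' + t * M < c.
Proof.
move=> cc' e0; pose t := Num.min (e / 2) (Num.min 2^-1 ((c - c') / (2 * (`|M - c'| + 1)))).
have d0 : 0 < 2 * (`|M - c'| + 1) by rewrite mulr_gt0// ltr_wpDl.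
have t0 : 0 < t by rewrite !lt_min invr_gt0 ltr0n !divr_gt0// subr_gt0.
exists t; first by rewrite t0 !gt_min invf_lt1 ?ltr1n// orbT.
split; first by rewrite gt_min; apply/orP; left; lra.
have td : t * (2 * (`|M - c'| + 1)) <= c - c'.
  by rewrite -ler_pdivlMr// !ge_min lexx !orbT.
have := ler_wpM2l (ltW t0) (ler_norm (M - c')).
have := mulr_ge0 (ltW t0) (normr_ge0 (M - c')).
nra.
Qed.

(** The corners [x ± 2 rho] of a cube lie in the domain. For large [k], each of these finitely many
    corners has a point within [rho] where [uk k] is below [M]; by [orthant_hull] such points have
    the ball of radius [rho] about [x] in their convex hull. *)
Lemma epi_upper_bounded uk u x :
  (forall k, ext_convex (uk k)) -> epi_upper uk u -> (dom u)° x ->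
  exists M r : R, 0 < r /\
    \forall k \near \oo, forall y, `|x - y| < r -> (uk k y <= M%:E)%E.
Proof.
move=> cuk up /nbhs_ballP[e /= e0 xeu].
pose rho := e / 4; have rho0 : 0 < rho by rewrite divr_gt0.
pose corner (s : {ffun 'I_n -> bool}) : 'rV[R]_n :=
  x + \row_i (if s i then 2 * rho else - (2 * rho)).
have corner_dom s : exists a : R, (u (corner s) < a%:E)%E.
  apply: dom_lt_fin; apply: (xeu (corner s)); rewrite -ball_normE /= opprD addrA subrr add0r normrN.
  apply/rV_norm_ltP => // i; rewrite mxE.
  rewrite (_ : `|_| = 2 * rho) /rho; first lra.
  by case: (s i); rewrite ?normrN gtr0_norm// mulr_gt0// divr_gt0.
have [a aP] := choice corner_dom.
pose M := \big[Num.max/0]_s a s; exists M, rho; split => //.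
have : \forall k \near \oo, forall s, exists2 y, ball (corner s) rho y & (uk k y < M%:E)%E.
  apply: filter_forall => s; apply: up => //; apply: lt_le_trans (aP s) _.
  by rewrite lee_fin /M; exact: le_bigmax.
apply: filterS => k kM y xy.
rewrite (_ : y = x + (y - x)); last by rewrite addrC subrK.
apply: (@orthant_hull R n [set z | (uk k (x + z)%R <= M%:E)%E] rho (y - x)) => //.
- move=> z w t uz uw t01 /=.
  rewrite (_ : x + _ = (1 - t) *: (x + z) + t *: (x + w)).
    exact: (is_convex_sublevel (cuk k)).
  by rewrite !scalerDr addrACA -scalerDl subrK scale1r.
- by rewrite distrC ltW.
move=> s; have [z + /ltW ukz] := kM (finfun s).
rewrite -ball_normE /= => /rV_norm_ltP -/(_ rho0) zs.
exists (z - x); first by rewrite /= addrC subrK.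
move=> i; have := zs i; rewrite !mxE ffunE ltr_norml.
case: (s i) => /andP[]; lra.
Qed.

(** The bound holds at some [y] very near [x]. Prolonging the segment from [y] through [x] to a
    point [z], where [uk k] is at most [M], makes [x] a convex combination with small weight on [z];
    the radius [t * r] keeps [z] in the ball of radius [r]. *)
Lemma epi_upper_interior uk u x (c : R) :
  (forall k, ext_convex (uk k)) -> epi_upper uk u -> (dom u)° x ->
  (u x < c%:E)%E -> \forall k \near \oo, (uk k x < c%:E)%E.
Proof.
move=> cuk up xu /ereal_real_between[c' [uc']]; rewrite lte_fin => cc'.
have [M [r [r0 near_r]]] := epi_upper_bounded cuk up xu.
have [t /andP[t0 t1] [_ tM]] := small_weight M cc' ltr01.
have tr0 : 0 < t * r by rewrite mulr_gt0.
apply: filterS2 near_r (up x c' (t * r) uc' tr0) => k kr [y + ukc'].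
rewrite -ball_normE /= => xy.
pose z := x + ((1 - t) / t) *: (x - y).
have xE : x = (1 - t) *: y + t *: z.
  by apply/rowP => i; rewrite /z !mxE; field; rewrite gt_eqF.
have uz : (uk k z <= M%:E)%E.
  apply: kr; rewrite /z opprD addrA subrr add0r normrN normrZ gtr0_norm; last first.
    by rewrite divr_gt0// subr_gt0.
  rewrite mulrAC ltr_pdivrMr// -[ltRHS]mul1r; apply: ltr_pM => //.
  - by rewrite subr_ge0 ltW.
  - lra.
  by rewrite mulrC.
rewrite {1}xE; apply: le_lt_trans (ext_convex_le _ _ (ltW ukc') uz) _ => //.
  by rewrite (ltW t0) ltW.
Qed.

Lemma epi_lower_compact uk u K (c : R) : epi_lower uk u -> compact K ->
  (forall x, K x -> (c%:E < u x)%E) ->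
  \forall k \near \oo, forall x, K x -> (c%:E < uk k x)%E.
Proof.
move=> low /compact_near_coveringP cK Kc.
apply: (cK _ _ (fun k x => (c%:E < uk k x)%E)) => x /Kc cux.
have [r r0 kr] := low x c cux.
exists (ball x r, [set k | forall y, ball x r y -> (c%:E < uk k y)%E]) => /=.
  by split => //; exact: nbhsx_ballx.
by move=> [y k] /= [xy]; exact.
Qed.

Lemma lsc_compact_lbound u K : lower_semicontinuous u -> (forall x, u x != -oo%E) ->
  compact K -> exists m : R, forall x, K x -> (m%:E < u x)%E.
Proof.
move=> lsc uNy /compact_near_coveringP cK.
have [N _ /(_ N (leqnn N)) KN] : \forall k \near \oo, K `<=` (fun x => ((- k%:R)%:E < u x)%E).
  apply: (cK _ _ (fun (k : nat) x => ((- k%:R)%:E < u x)%E)) => x _.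
  have [c [_ cux]] : exists c : R, (-oo < c%:E)%E /\ (c%:E < u x)%E.
    by apply: ereal_real_between; rewrite ltNye.
  have [V nV Vc] := lsc x c cux.
  exists (V, [set k | - c <= k%:R]) => /=.
    by split => //; exact: nbhs_infty_ger.
  move=> [y k] /= [/Vc cy ck]; apply: le_lt_trans cy.
  by rewrite lee_fin lerNl.
by exists (- N%:R).
Qed.

Lemma dist_continuous (z : 'rV[R]_n) : continuous (fun x : 'rV[R]_n => `|x - z|).
Proof.
move=> x; apply/(@cvgrPdist_lt _ _ _ (nbhs x)) => e e0; apply/nbhs_ballP.
exists e => //= y; rewrite -ball_normE /= => xy.
apply: le_lt_trans (ler_dist_dist _ _) _.
by rewrite opprB addrA subrK.
Qed.

Lemma compact_norm_ball (z : 'rV[R]_n) (P : set 'rV[R]_n) (r : R) :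
  closed P -> compact [set x | P x /\ `|x - z| <= r].
Proof.
move=> clP; apply: bounded_closed_compact.
  exists (r + `|z|); split => [|M rM]; first exact: num_real.
  move=> x [_ xzr] /=; rewrite (le_trans _ (ltW rM))// -lerBlDr (le_trans _ xzr)//.
  by rewrite lerB_dist.
apply: closedI => //.
apply: (@closed_comp _ _ (fun x : 'rV[R]_n => `|x - z|) [set s | s <= r]); last exact: closed_le.
by move=> x _; exact: dist_continuous.
Qed.

(** For large [k], [uk k] is below [c0] at some [w] within 1 of [z] and above [c0 + 1] on an annulus
    about [z]. Convexity along rays from [w] then forces a slope of at least [1 / (r + 1)] outside;
    inside, a lower bound on a compact ball suffices. *)
Lemma epi_cone uk u : (forall k, ext_convex (uk k)) ->
  lower_semicontinuous u -> (forall x, u x != -oo%E) -> coercive u ->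
  (exists x, u x != +oo%E) -> epi_lower uk u -> epi_upper uk u ->
  exists a b : R, 0 < a /\
    \forall k \near \oo, forall x, ((a * `|x| + b)%:E <= uk k x)%E.
Proof.
move=> cuk lsc uNy cou [z /dom_lt_fin[c0 uzc]] low up.
have [r' r'u] := cou (c0 + 1).
pose r := `|r'| + `|z| + 1.
have r0 : 0 < r by rewrite ltr_wpDl// addr_ge0.
(* Width 2 lets the annulus contain the sphere of radius [r + 1] about any [w] within 1 of [z]. *)
pose K1 := [set x | r <= `|x - z| /\ `|x - z| <= r + 2].
pose K2 := [set x : 'rV[R]_n | True /\ `|x - z| <= r + 2].
have cpt1 : compact K1.
  apply: compact_norm_ball.
  apply: (@closed_comp _ _ (fun x : 'rV[R]_n => `|x - z|) [set s | r <= s]); last exact: closed_ge.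
  by move=> x _; exact: dist_continuous.
have cpt2 : compact K2 by apply: compact_norm_ball; exact: closedT.
have [m mK2] := lsc_compact_lbound lsc uNy cpt2.
have K1c x : K1 x -> ((c0 + 1)%:E < u x)%E.
  move=> [rx _]; apply: r'u; apply: (le_lt_trans (ler_norm r')).
  have := ler_normB x z; move: rx; rewrite /r; lra.
have near1 := epi_lower_compact low cpt1 K1c.
have near2 := epi_lower_compact low cpt2 mK2.
pose a := (r + 1)^-1.
have a0 : 0 < a by rewrite invr_gt0 addr_gt0.
(* The first term puts the cone below [m] where [|x - w| <= r + 1], the second puts it below
   [c0 + a * |x - w|] everywhere. *)
exists a, (Num.min (m - a * (r + `|z| + 2)) (c0 - a * (`|z| + 1))); split => //.
have near3 := up z c0 1 uzc ltr01.
apply: filterS3 near1 near2 near3 => k k1 k2 [w + ukw] x.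
rewrite -ball_normE /= => zw; set b := Num.min _ _.
have bm : b <= m - a * (r + `|z| + 2) by rewrite ge_min lexx.
have bc : b <= c0 - a * (`|z| + 1) by rewrite ge_min lexx orbT.
have xD : `|x| <= `|x - w| + `|z| + 1.
  have := ler_normD (x - w) w; rewrite subrK.
  have := ler_normB z (z - w); rewrite opprB addrC subrK; lra.
have axD := ler_wpM2l (ltW a0) xD.
have [xw|xw] := leP `|x - w| (r + 1).
  apply: (@le_trans _ _ m%:E).
    have := ler_wpM2l (ltW a0) xw; rewrite lee_fin; lra.
  apply/ltW/k2; split => //; rewrite (le_trans (ler_distD w _ _))//.
  by rewrite (distrC w z); lra.
apply: (@le_trans _ _ (c0 + a * `|x - w|)%:E); first by rewrite lee_fin; lra.
rewrite leNgt; apply/negP => /ltW ukx.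
pose D := `|x - w|; have D0 : 0 < D by rewrite (lt_trans _ xw)// addr_gt0.
(* The weight that places the point of the segment from [w] to [x] at distance [r + 1] from [w],
   where the chord takes the value [c0 + 1]. *)
pose s := (r + 1) / D.
have s01 : 0 <= s <= 1.
  by rewrite divr_ge0 ?ler_pdivrMr ?mul1r ?(ltW xw) ?(ltW D0)// addr_ge0// ltW.
have := ext_convex_le (cuk k) s01 (ltW ukw) ukx.
have -> : (1 - s) * c0 + s * (c0 + a * D) = c0 + 1.
  by rewrite /s /a; field; rewrite !gt_eqF// addr_gt0.
rewrite leNgt => /negP; apply; apply: k1.
set y := _ + _.
have yw : `|y - w| = r + 1.
  rewrite (_ : y - w = s *: (x - w)).
    rewrite normrZ ger0_norm; last by case/andP: s01.
    by rewrite /s divfK// gt_eqF.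
  by apply/rowP => i; rewrite /y !mxE; ring.
split.
  have := ler_distD z y w; rewrite yw; lra.
by rewrite (le_trans (ler_distD w _ _))// yw (distrC w z); lra.
Qed.

End convex_functions.

(** * The functional delta *)

Section delta_basics.
Variables (R : realType) (n : nat) (p : R) (zeta : R -> R).
Hypothesis p1 : 1 <= p.
Hypothesis zetaM : M_class n p zeta.
Implicit Types u v w : 'rV[R]_n -> \bar R.

Let p0 : 0 < p. Proof. exact: lt_le_trans p1. Qed.
Let zeta_cont : continuous zeta. Proof. by case: zetaM. Qed.
Let zeta_gt0 t : 0 < zeta t. Proof. by case: zetaM. Qed.
Let zeta_decr s t : s < t -> zeta t < zeta s. Proof. by case: zetaM => _ _ + _; apply. Qed.
Let zeta_noninc s t : s <= t -> zeta t <= zeta s.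
Proof. by rewrite le_eqVlt => /orP[/eqP -> //|/zeta_decr/ltW]. Qed.

Local Notation F u x := (zeta_ext zeta (u x)).

Lemma zeta_ext_ge0 y : 0 <= zeta_ext zeta y.
Proof. by case: y => //= r; exact: ltW. Qed.

Lemma zeta_ext_le (c : R) y : (c%:E <= y)%E -> zeta_ext zeta y <= zeta c.
Proof.
case: y => [r| |] //=; first by rewrite lee_fin => /zeta_noninc.
by move=> _; exact: ltW.
Qed.

Lemma zeta_ext_lt (c : R) y : (c%:E < y)%E -> zeta_ext zeta y < zeta c.
Proof. by case: y => [r| |] //=; rewrite lte_fin => /zeta_decr. Qed.

Lemma zeta_ext_gt (c : R) y : y != -oo%E -> (y < c%:E)%E -> zeta c < zeta_ext zeta y.
Proof. by case: y => [r| |] //=; rewrite lte_fin => _ /zeta_decr. Qed.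

Lemma zeta_ext_measurable u : lower_semicontinuous u ->
  measurable_fun setT (fun x : Rn R n => F u x).
Proof.
move=> /lsc_measurable_Rn mu_.
rewrite (_ : (fun x => _) =
    (fun x : Rn R n => if u x == +oo%E then 0 else
      if u x == -oo%E then 0 else zeta (fine (u x)))); last first.
  by apply/funext => x; case: (u x).
apply: measurable_fun_ifT => //; first exact: measurable_fun_eqe.
apply: measurable_fun_ifT => //; first exact: measurable_fun_eqe.
apply: (measurableT_comp (continuous_measurable_fun zeta_cont)).
exact: (measurableT_comp _ mu_).
Qed.

Definition integrand u v (x : Rn R n) : \bar R := (`|F u x - F v x| `^ p)%:E.

Lemma integrand_ge0 u v x : (0 <= integrand u v x)%E.
Proof. by rewrite lee_fin powR_ge0. Qed.

Lemma integrand_measurable u v : lower_semicontinuous u -> lower_semicontinuous v ->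
  measurable_fun setT (integrand u v).
Proof.
move=> lu lv; apply/measurable_EFinP.
apply: (measurableT_comp (measurable_powR p)).
apply: measurableT_comp => //.
by apply: measurable_funB; exact: zeta_ext_measurable.
Qed.

Lemma deltaE u v : lower_semicontinuous u -> lower_semicontinuous v ->
  delta zeta p u v = ((\int[lebesgue_Rn R n]_x integrand u v x) `^ p^-1)%E.
Proof.
move=> lu lv; rewrite /delta -integral_RnE//; first exact: integrand_measurable.
exact: integrand_ge0.
Qed.

(** Seen as an L^p norm of a difference, [delta] inherits the triangle inequality from Minkowski. *)
Lemma delta_LnormE u v : lower_semicontinuous u -> lower_semicontinuous v ->
  delta zeta p u v = ('N[lebesgue_Rn R n]_p%:E[EFin \o (fun x : Rn R n => (F u x - F v x)%R)])%E.
Proof. by move=> lu lv; rewrite deltaE// unlock. Qed.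

Lemma delta_triangle u v w : lower_semicontinuous u -> lower_semicontinuous v ->
  lower_semicontinuous w ->
  (delta zeta p u w <= delta zeta p u v + delta zeta p v w)%E.
Proof.
move=> lu lv lw; rewrite !delta_LnormE//.
have := @minkowski_EFin _ (Rn R n) R (lebesgue_Rn R n) (fun x => F u x - F v x) (fun x => F v x - F w x) p.
rewrite (_ : ((fun x => _) \+ _)%R = (fun x => F u x - F w x)); last first.
  by apply/funext => x /=; rewrite addrA subrK.
apply => //; apply: measurable_funB; exact: zeta_ext_measurable.
Qed.

Lemma deltaC u v : delta zeta p u v = delta zeta p v u.
Proof.
by rewrite /delta; congr (integral_Rn _ `^ _)%E; apply/funext => x; rewrite distrC.
Qed.

Lemma delta_ge0 u v : (0 <= delta zeta p u v)%E.
Proof. exact: poweR_ge0. Qed.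

Lemma deltaxx u : lower_semicontinuous u -> delta zeta p u u = 0%E.
Proof.
move=> lu; rewrite deltaE// integral0_eq ?poweR0r// ?invr_neq0 ?gt_eqF//.
by move=> x _; rewrite /integrand subrr normr0 powR0// gt_eqF.
Qed.

Let phi t := zeta t `^ p.

Lemma zeta_powR_continuous : continuous phi.
Proof.
move=> t; apply: (@continuous_comp _ _ _ zeta (fun s => s `^ p)); first exact: zeta_cont.
apply: differentiable_continuous; apply/derivable1_diffP/derivable_powR.
by rewrite in_itv /= andbT.
Qed.

Lemma zeta_powR_noninc s t : s <= t -> phi t <= phi s.
Proof.
move=> st; apply: ge0_ler_powR; rewrite ?nnegrE ?(ltW p0) ?(ltW (zeta_gt0 _))//.
exact: zeta_noninc.
Qed.

Lemma cone_integrable a b : 0 < a ->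
  (lebesgue_Rn R n).-integrable setT (fun x : Rn R n => (phi (a * `|x : 'rV[R]_n| + b))%:E : \bar R).
Proof.
move=> a0; apply/integrableP; split.
  apply/measurable_EFinP.
  have mg : measurable_fun [set: R] (fun r => phi (a * r + b)).
    apply: (measurableT_comp (continuous_measurable_fun zeta_powR_continuous)).
    by apply: measurable_funD => //; exact: measurable_funM.
  exact: (measurableT_comp mg (@norm_measurable_Rn R n)).
under eq_integral do rewrite gee0_abs ?lee_fin ?powR_ge0//.
apply: integral_cone_Rn_lty => //.
- exact: zeta_powR_continuous.
- by move=> t; exact: powR_ge0.
- exact: zeta_powR_noninc.
by case: zetaM.
Qed.

Lemma integrand_le_cone u v a b x :
  ((a * `|x : 'rV[R]_n| + b)%:E <= u x)%E -> ((a * `|x : 'rV[R]_n| + b)%:E <= v x)%E ->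
  (integrand u v x <= (phi (a * `|x : 'rV[R]_n| + b))%:E)%E.
Proof.
move=> /zeta_ext_le ux /zeta_ext_le vx; rewrite lee_fin.
apply: ge0_ler_powR; rewrite ?nnegrE ?(ltW p0)//; first exact: ltW.
have := zeta_ext_ge0 (u x); have := zeta_ext_ge0 (v x).
rewrite ler_norml; lra.
Qed.

(** Otherwise [zeta] is at least [e] everywhere and the moment integral diverges on [[1, +oo[],
    where the power of [t] is at least 1. *)
Lemma zeta_vanishes (e : R) : 0 < e -> exists M, zeta M < e.
Proof.
move=> e0; apply: contrapT => /forallNP ze.
have {}ze t : e <= zeta t by rewrite leNgt; apply/negP; exact: ze.
case: zetaM => _ _ _; apply/negP; rewrite -leNgt leye_eq.
have mI : measurable_fun [set: R] (fun t => (zeta t `^ p * t ^+ n.-1)%:E : \bar R).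
  apply/measurable_EFinP; apply: measurable_funM; last exact: measurable_funX.
  exact: (continuous_measurable_fun zeta_powR_continuous).
have I0 (t : R) : 0 <= t -> (0 <= (zeta t `^ p * t ^+ n.-1)%:E :> \bar R)%E.
  by move=> t0; rewrite lee_fin; apply: mulr_ge0; [exact: powR_ge0|exact: exprn_ge0].
rewrite -leye_eq.
apply: (@le_trans _ _ (\int[@lebesgue_measure R]_(t in `[1%R, +oo[) (cst (e `^ p)%:E t))%E).
  rewrite integral_cst// [X in (_ * X)%E](lebesgue_measure_itv _) /= ltry gt0_muley//.
  by rewrite lte_fin powR_gt0.
apply: (@le_trans _ _ (\int[@lebesgue_measure R]_(t in `[1%R, +oo[) (zeta t `^ p * t ^+ n.-1)%:E)%E).
  apply: ge0_le_integral => //.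
  - by move=> t _; rewrite lee_fin powR_ge0.
  - exact: measurable_funS mI.
  move=> t; rewrite /= in_itv /= andbT => t1; rewrite lee_fin -[leLHS]mulr1.
  apply: ler_pM => //; rewrite ?powR_ge0 ?exprn_ege1//.
  by apply: ge0_ler_powR; rewrite ?nnegrE ?(ltW p0) ?(ltW e0) ?(ltW (zeta_gt0 _)).
apply: ge0_subset_integral => //.
- exact: measurable_funS mI.
- by move=> t; rewrite /= in_itv /= andbT; exact: I0.
- move=> t; rewrite /= !in_itv /= !andbT; exact: le_trans.
Qed.

Lemma ge0_cvge0P (f : nat -> \bar R) : (forall k, 0 <= f k)%E ->
  f @ \oo --> 0%E <-> (forall e : R, 0 < e -> \forall k \near \oo, (f k < e%:E)%E).
Proof.
move=> f0; split => [f_cvg e e0|near_e].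
  apply: (f_cvg [set y | (y < e%:E)%E]); apply: open_nbhs_nbhs; split.
    exact: open_ereal_lt_ereal.
  by rewrite /= lte_fin.
apply/fine_cvgP; split.
  apply: filterS (near_e 1 ltr01) => k fk.
  by rewrite ge0_fin_numE// (lt_trans fk) ?ltry.
apply/cvgrPdist_lt => e e0; apply: filterS (near_e e e0) => k /= fk.
rewrite sub0r normrN ger0_norm ?fine_ge0//.
by rewrite -lte_fin fineK// ge0_fin_numE// (lt_trans fk) ?ltry.
Qed.

Lemma delta_cvg0P (uk : nat -> 'rV[R]_n -> \bar R) u :
  (forall k, lower_semicontinuous (uk k)) -> lower_semicontinuous u ->
  (fun k => delta zeta p (uk k) u) @ \oo --> 0%E <->
  (forall e : R, 0 < e -> \forall k \near \oo,
     (\int[lebesgue_Rn R n]_x integrand (uk k) u x < e%:E)%E).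
Proof.
move=> luk lu; rewrite ge0_cvge0P; last by move=> k; exact: delta_ge0.
have I0 k : (0 <= \int[lebesgue_Rn R n]_x integrand (uk k) u x)%E.
  by apply: integral_ge0 => x _; exact: integrand_ge0.
have in0y (y : \bar R) : (0 <= y)%E -> y \in `[0%E, +oo%E].
  by move=> y0; rewrite in_itv /= y0 leey.
split=> small e e0.
  have e0' : 0 < e `^ p^-1 by rewrite powR_gt0.
  apply: filterS (small _ e0') => k; apply: contraTT; rewrite -!leNgt deltaE// => eI.
  rewrite -poweR_EFin; apply: gt0_ler_poweR => //; last exact: in0y.
    by rewrite invr_ge0 ltW.
  by apply: in0y; rewrite lee_fin ltW.
have e0' : 0 < e `^ p by rewrite powR_gt0.
apply: filterS (small _ e0') => k; apply: contraTT; rewrite -!leNgt deltaE// => eI.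
rewrite -poweR_EFin -[leRHS]poweRe1// -(mulVf (lt0r_neq0 p0)) poweRrM.
apply: gt0_ler_poweR => //; first exact: ltW.
- by apply: in0y; rewrite lee_fin ltW.
- by apply: in0y; exact: poweR_ge0.
Qed.

(** Chebyshev: a gap of [eta] on the whole ball would make the integral at least [eta ^ p] times the
    volume [(2 r) ^ n]. *)
Lemma delta_cvg0_ball (uk : nat -> 'rV[R]_n -> \bar R) u z (r eta : R) :
  (forall k, lower_semicontinuous (uk k)) -> lower_semicontinuous u ->
  (fun k => delta zeta p (uk k) u) @ \oo --> 0%E -> 0 < r -> 0 < eta ->
  \forall k \near \oo, exists2 y, ball z r y & `|F (uk k) y - F u y| < eta.
Proof.
move=> luk lu /(delta_cvg0P luk lu) small r0 eta0.
have e0 : 0 < eta `^ p * (r *+ 2) ^+ n.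
  by rewrite mulr_gt0 ?powR_gt0// exprn_gt0// pmulrn_lgt0.
apply: filterS (small _ e0) => k; apply: contraPP => /forall2NP far.
apply/negP; rewrite -leNgt EFinM -(lebesgue_Rn_ball z r0) -[ball z r]setIT.
rewrite -integral_indic//; last exact: measurable_ball_Rn.
rewrite -ge0_integralZl_EFin ?powR_ge0//; last first.
  by apply/measurable_EFinP/measurable_indic; exact: measurable_ball_Rn.
apply: ge0_le_integral => //.
- by move=> x _; rewrite -EFinM lee_fin mulr_ge0// powR_ge0.
- by apply: measurable_funeM; apply/measurable_EFinP/measurable_indic; exact: measurable_ball_Rn.
- exact: integrand_measurable.
move=> x _; rewrite indicE.
have [zx|zx] := pselect (ball z r x); last first.
  by rewrite memNset// mule0 integrand_ge0.
rewrite mem_set// mule1 lee_fin; apply: ge0_ler_powR; rewrite ?nnegrE ?(ltW p0) ?(ltW eta0)//.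
by have [//|/negP] := far x; rewrite -leNgt.
Qed.

End delta_basics.

(** * Convergence *)

Section metric_epi.
Variables (R : realType) (n : nat) (p : R) (zeta : R -> R).
Hypothesis p1 : 1 <= p.
Hypothesis zetaM : M_class n p zeta.
Implicit Types u v w : 'rV[R]_n -> \bar R.

Let p0 : 0 < p. Proof. exact: lt_le_trans p1. Qed.
Local Notation F u x := (zeta_ext zeta (u x)).

(** Viewing one function as a constant sequence makes the bounds for sequences available for it. *)
Lemma epi_lower_cst u : lower_semicontinuous u -> epi_lower (fun=> u) u.
Proof.
move=> lsc x c /(lsc x)[V /nbhs_ballP[r /= r0 xrV] Vc].
by exists r => //; apply: nearW => k y /xrV/Vc.
Qed.

Lemma epi_upper_cst u : epi_upper (fun=> u) u.
Proof.
by move=> x c r uxc r0; apply: nearW => k; exists x => //; exact: ballxx.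
Qed.

Lemma Conv_dom_interior u : Conv_coe_n u -> exists z, (dom u)° z.
Proof.
move=> [_ _ _ cu [_ [pts [domp aff]]]].
exact: (simplex_interior (is_convex_dom cu) domp aff).
Qed.

Lemma Conv_cone u : Conv_coe_n u ->
  exists a b : R, 0 < a /\ forall x, ((a * `|x| + b)%:E <= u x)%E.
Proof.
move=> [uNy du lu cu [cou _]].
have [a [b [a0 [N _ /(_ N (leqnn N)) abN]]]] := epi_cone (fun=> cu) lu uNy cou du
  (epi_lower_cst lu) (@epi_upper_cst u).
by exists a, b.
Qed.

Lemma Conv_delta_fin u v : Conv_coe_n u -> Conv_coe_n v ->
  delta zeta p u v \is a fin_num.
Proof.
move=> Cu Cv; have [_ _ lu _ _] := Cu; have [_ _ lv _ _] := Cv.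
have [a [b [a0 abu]]] := Conv_cone Cu; have [a' [b' [a0' abv]]] := Conv_cone Cv.
pose c := Num.min a a'; pose d := Num.min b b'.
have c0 : 0 < c by rewrite lt_min a0.
have cdu x : ((c * `|x| + d)%:E <= u x)%E.
  apply: le_trans (abu x); rewrite lee_fin lerD ?ler_wpM2r// ge_min lexx//.
have cdv x : ((c * `|x| + d)%:E <= v x)%E.
  by apply: le_trans (abv x); rewrite lee_fin lerD ?ler_wpM2r// ge_min lexx orbT.
rewrite (deltaE zetaM lu lv) fin_num_poweR// ge0_fin_numE; last first.
  by apply: integral_ge0 => x _; exact: integrand_ge0.
have /integrableP[mphi] := cone_integrable p1 zetaM d c0.
apply: le_lt_trans; apply: ge0_le_integral => //.
- by move=> x _; exact: integrand_ge0.
- exact: integrand_measurable.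
- exact: measurableT_comp.
move=> x _; apply: le_trans (lee_abs _).
exact: integrand_le_cone.
Qed.

(** The contraction of ratio [t] towards [x] maps an interior ball, on which [u] is at most [M], to
    a ball near [x] on which [u < c1]. Were [uk k] at least [c] on all of it, [zeta] would leave a
    gap above [zeta c1 - zeta c] there. *)
Lemma delta_cvg0_upper (uk : nat -> 'rV[R]_n -> \bar R) u :
  (forall k, Conv_coe_n (uk k)) -> Conv_coe_n u ->
  (fun k => delta zeta p (uk k) u) @ \oo --> 0%E -> epi_upper uk u.
Proof.
move=> Cuk Cu dcvg x c r uxc r0.
have [uNy _ lu cu _] := Cu.
have luk k : lower_semicontinuous (uk k) by have [] := Cuk k.
have ukNy k y : uk k y != -oo%E by have [] := Cuk k.
have [z zu] := Conv_dom_interior Cu.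
have [M [rho [rho0 [N _ /(_ N (leqnn N)) uM]]]] :=
  epi_upper_bounded (fun=> cu) (@epi_upper_cst u) zu.
have [c1 [uc1]] := ereal_real_between uxc; rewrite lte_fin => c1c.
have [c2 [uc2]] := ereal_real_between uc1; rewrite lte_fin => c2c1.
have e0 : 0 < r / (`|z - x| + rho) by rewrite divr_gt0// ltr_wpDl.
have [t /andP[t0 t1] [te tM]] := small_weight M c2c1 e0.
have {}te : t * (`|z - x| + rho) < r by rewrite -ltr_pdivlMr// ltr_wpDl.
pose q := (1 - t) *: x + t *: z.
have trho0 : 0 < t * rho by rewrite mulr_gt0.
have eta0 : 0 < zeta c1 - zeta c by rewrite subr_gt0; case: zetaM => _ _ + _; apply.
have := @delta_cvg0_ball R n p zeta p1 zetaM uk u q _ _ luk lu dcvg trho0 eta0.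
apply: filterS => k [w]; rewrite -ball_normE /= => qw Fw.
have uw : (u w < c1%:E)%E.
  (* The preimage of [w] under the contraction; it lies within [rho] of [z]. *)
  pose y := z + t^-1 *: (w - q).
  have -> : w = (1 - t) *: x + t *: y.
    by apply/rowP => i; rewrite /y /q !mxE; field; rewrite gt_eqF.
  have uy : (u y <= M%:E)%E.
    apply: uM; rewrite /y opprD addrA subrr add0r normrN normrZ gtr0_norm ?invr_gt0//.
    by rewrite mulrC ltr_pdivrMr// distrC mulrC.
  apply: le_lt_trans (ext_convex_le cu _ (ltW uc2) uy) _; last by rewrite lte_fin.
  by rewrite (ltW t0) ltW.
exists w.
  have -> : x - w = (q - w) - t *: (z - x).
    by apply/rowP => i; rewrite /q !mxE; ring.
  apply: le_lt_trans (ler_normB _ _) _; rewrite normrZ gtr0_norm//.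
  by move: te qw; rewrite mulrDr; lra.
rewrite ltNge; apply/negP => cukw.
have := zeta_ext_le zetaM cukw; have := zeta_ext_gt zetaM (uNy w) uw.
move: Fw; rewrite ltr_norml => /andP[]; lra.
Qed.

(** If [uk k y <= c] for some [y] near [x], convexity and the bound [M] near [z] give [uk k < c1] on
    a small ball about [q], where [u > c2] by semicontinuity. The gap between [zeta c1] and
    [zeta c2] contradicts smallness of [delta]. *)
Lemma delta_cvg0_lower (uk : nat -> 'rV[R]_n -> \bar R) u :
  (forall k, Conv_coe_n (uk k)) -> Conv_coe_n u ->
  (fun k => delta zeta p (uk k) u) @ \oo --> 0%E -> epi_lower uk u.
Proof.
move=> Cuk Cu dcvg x c cux.
have [uNy _ lu cu _] := Cu.
have luk k : lower_semicontinuous (uk k) by have [] := Cuk k.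
have cuk k : ext_convex (uk k) by have [] := Cuk k.
have ukNy k y : uk k y != -oo%E by have [] := Cuk k.
have [z zu] := Conv_dom_interior Cu.
have up := delta_cvg0_upper Cuk Cu dcvg.
have [M [rho [rho0 near_M]]] := epi_upper_bounded cuk up zu.
have [c2 [cc2 c2u]] := ereal_real_between cux.
have [c1 [cc1 c12]] := ereal_real_between cc2.
move: cc1 c12; rewrite !lte_fin => cc1 c12.
have [V /nbhs_ballP[r /= r0 xrV] Vc2] := lu x c2 c2u.
have e0 : 0 < r / (`|z - x| + rho) by rewrite divr_gt0// ltr_wpDl.
have [t /andP[t0 t1] [te tM]] := small_weight M cc1 e0.
have {}te : t * (`|z - x| + rho) < r by rewrite -ltr_pdivlMr// ltr_wpDl.
pose q := (1 - t) *: x + t *: z.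
(* The radius [t * rho] is shared equally between the displacement of [w] from [q] and that of [y]
   from [x]. *)
have s0 : 0 < t * rho / 2 by rewrite divr_gt0// mulr_gt0.
have eta0 : 0 < zeta c1 - zeta c2 by rewrite subr_gt0; case: zetaM => _ _ + _; apply.
exists (t * rho / 2) => //.
have := @delta_cvg0_ball R n p zeta p1 zetaM uk u q _ _ luk lu dcvg s0 eta0.
apply: filterS2 near_M => k kM [w]; rewrite -ball_normE /= => qw Fw y.
move=> xy; rewrite ltNge; apply/negP => uky.
have uw : (c2%:E < u w)%E.
  apply/Vc2/xrV; rewrite -ball_normE /=.
  have -> : x - w = (q - w) - t *: (z - x).
    by apply/rowP => i; rewrite /q !mxE; ring.
  apply: le_lt_trans (ler_normB _ _) _; rewrite normrZ gtr0_norm//.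
  by move: te qw s0; rewrite mulrDr; lra.
have ukw : (uk k w < c1%:E)%E.
  pose y' := z + t^-1 *: ((w - q) + (1 - t) *: (x - y)).
  have -> : w = (1 - t) *: y + t *: y'.
    by apply/rowP => i; rewrite /y' /q !mxE; field; rewrite gt_eqF.
  have uy' : (uk k y' <= M%:E)%E.
    apply: kM; rewrite /y' opprD addrA subrr add0r normrN normrZ gtr0_norm ?invr_gt0//.
    rewrite mulrC ltr_pdivrMr// (le_lt_trans (ler_normD _ _))// normrZ.
    rewrite ger0_norm ?subr_ge0 ?(ltW t1)// distrC [rho * t]mulrC.
    have : (1 - t) * `|x - y| <= `|x - y| by rewrite ler_piMl// lerBlDr lerDl ltW.
    lra.
  apply: le_lt_trans (ext_convex_le (cuk k) _ uky uy') _; last by rewrite lte_fin.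
  by rewrite (ltW t0) ltW.
have := zeta_ext_lt zetaM uw; have := zeta_ext_gt zetaM (ukNy k w) ukw.
move: Fw; rewrite ltr_norml => /andP[]; lra.
Qed.

(** The domain is the countable union of the sublevel sets [C m], compact by coercivity and
    semicontinuity, and convex. A point not interior to the domain is interior to no [C m]. *)
Lemma dom_boundary_negligible u : Conv_coe_n u ->
  (lebesgue_Rn R n).-negligible (dom u `\` (dom u)°).
Proof.
move=> [uNy _ lu cu [cou _]].
pose C (m : nat) : set 'rV[R]_n := [set x | (u x <= m%:R%:E)%E].
have cptC m : compact (C m).
  apply: bounded_closed_compact.
    have [r ru] := cou m%:R.
    exists r; split => [|s rs x /= uxm]; first exact: num_real.
    rewrite leNgt; apply/negP => sx; have := ru x (lt_trans rs sx).
    by rewrite ltNge uxm.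
  rewrite (_ : C m = ~` [set x | (m%:R%:E < u x)%E]).
    by apply: open_closedC; move/lower_semicontinuousP : lu; apply.
  by apply/seteqP; split => x /=; rewrite /C /= leNgt => /negP.
have domC : dom u `\` (dom u)° `<=` \bigcup_m (C m `\` (C m)°).
  move=> x [/dom_lt_fin[a uxa] Dx]; have [m _ /(_ m (leqnn m)) am] := nbhs_infty_ger a.
  exists m => //; split.
    by rewrite /C /= (le_trans (ltW uxa))// lee_fin.
  apply: contra_not Dx; apply: filterS => y /= Cy.
  by rewrite /dom /= -ltey (le_lt_trans Cy)// ltry.
apply: (negligibleS (domC : _ `<=` (_ : set (Rn R n)))).
apply: negligible_bigcup => m; apply/negligibleP.
  apply: measurableD.
    rewrite -(setCK (C m)); apply: measurableC; apply: open_measurable_Rn.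
    by rewrite openC; apply: compact_closed (cptC m); exact: norm_hausdorff.
  by apply: open_measurable_Rn; exact: open_interior.
apply: is_convex_boundary0; first exact: cptC.
exact: is_convex_sublevel.
Qed.

(** Outside the domain, [uk k x] exceeds any bound and [zeta] vanishes at infinity; in the interior,
    the lower and upper bounds confine [uk k x] to a neighbourhood of [u x], and [zeta] is
    continuous. *)
Lemma epi_zeta_cvg (uk : nat -> 'rV[R]_n -> \bar R) u x :
  (forall k, Conv_coe_n (uk k)) -> Conv_coe_n u ->
  epi_lower uk u -> epi_upper uk u -> ~ (dom u `\` (dom u)°) x ->
  forall e : R, 0 < e -> \forall k \near \oo, `|F (uk k) x - F u x| < e.
Proof.
move=> Cuk Cu low up nx e e0.
have cuk k : ext_convex (uk k) by have [] := Cuk k.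
have [uNy _ _ _ _] := Cu.
have ukNy k y : uk k y != -oo%E by have [] := Cuk k.
have [uxy|uxNy] := eqVneq (u x) +oo%E.
  have [M zM] := zeta_vanishes p1 zetaM e0.
  have Mu : (M%:E < u x)%E by rewrite uxy ltry.
  have [r r0] := low x M Mu; apply: filterS => k /(_ x (ballxx _ r0)) /(zeta_ext_lt zetaM).
  rewrite uxy /= subr0 ger0_norm ?(zeta_ext_ge0 zetaM)//.
  by move/lt_trans; apply.
have xint : (dom u)° x by apply: contrapT => xint; apply: nx.
have uxE : u x = (fine (u x))%:E by rewrite fineK// fin_numE uNy.
set a := fine (u x) in uxE.
have /(_ a)/(@cvgrPdist_lt _ _ _ (nbhs a))/(_ e e0)/nbhs_ballP[d /= d0 ad] :
  continuous zeta by case: zetaM.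
have lo : ((a - d)%:E < u x)%E by rewrite uxE lte_fin ltrBlDr ltrDl.
have hi : (u x < (a + d)%:E)%E by rewrite uxE lte_fin ltrDl.
have [r r0 near_lo] := low x _ lo.
have near_hi := epi_upper_interior cuk up xint hi.
apply: filterS2 near_lo near_hi => k /(_ x (ballxx _ r0)).
rewrite uxE; case: (uk k x) => [s| |] //=; rewrite !lte_fin => ads sad.
rewrite distrC; apply: ad; rewrite -ball_normE /= ltr_norml.
by apply/andP; split; lra.
Qed.

Lemma epi_delta_cvg0 (uk : nat -> 'rV[R]_n -> \bar R) u :
  (forall k, Conv_coe_n (uk k)) -> Conv_coe_n u ->
  epi_lower uk u -> epi_upper uk u ->
  (fun k => delta zeta p (uk k) u) @ \oo --> 0%E.
Proof.
move=> Cuk Cu low up.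
have [uNy du lu cu [cou _]] := Cu.
have luk k : lower_semicontinuous (uk k) by have [] := Cuk k.
have cuk k : ext_convex (uk k) by have [] := Cuk k.
have [a [b [a0 abu]]] := Conv_cone Cu.
have [a' [b' [a0' [N _ abk]]]] := epi_cone cuk lu uNy cou du low up.
pose c := Num.min a a'; pose d := Num.min b b'.
have c0 : 0 < c by rewrite lt_min a0.
have cdu x : ((c * `|x| + d)%:E <= u x)%E.
  by apply: le_trans (abu x); rewrite lee_fin lerD ?ler_wpM2r// ge_min lexx.
have cdk k x : (N <= k)%N -> ((c * `|x| + d)%:E <= uk k x)%E.
  move=> Nk; apply: le_trans (abk k Nk x).
  by rewrite lee_fin lerD ?ler_wpM2r// ge_min lexx orbT.
have I0 k : (0 <= \int[lebesgue_Rn R n]_x integrand p zeta (uk k) u x)%E.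
  by apply: integral_ge0 => x _; exact: integrand_ge0.
apply/(delta_cvg0P p1 zetaM luk lu)/(ge0_cvge0P I0).
(* The integrable majorant is available only from index [N] on. *)
rewrite -(cvg_shiftn N).
have [] := @dominated_convergence _ (Rn R n) R (lebesgue_Rn R n) setT measurableT
  (fun k => integrand p zeta (uk (k + N)%N) u) (cst 0%E)
  (fun x : Rn R n => (zeta (c * `|x : 'rV[R]_n| + d) `^ p)%:E).
- by move=> k; exact: integrand_measurable.
- exact: measurable_cst.
- apply: negligibleS (dom_boundary_negligible Cu) => x /= /not_implyP[_].
  apply: contra_notP => nx.
  have G0 k : (0 <= integrand p zeta (uk (k + N)%N) u x)%E by exact: integrand_ge0.
  apply/(ge0_cvge0P G0) => e e0.
  have e0' : 0 < e `^ p^-1 by rewrite powR_gt0.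
  have [N' _ small] := epi_zeta_cvg Cuk Cu low up nx e0'.
  exists N' => // k /= N'k; rewrite lte_fin.
  have -> : e = (e `^ p^-1) `^ p by rewrite -powRrM mulVf ?gt_eqF// powRr1// ltW.
  apply: gt0_ltr_powR; rewrite ?nnegrE ?(ltW e0')//.
  by apply: small; rewrite /= (leq_trans N'k)// leq_addr.
- exact: cone_integrable.
- apply: aeW => x k _; rewrite gee0_abs ?integrand_ge0//.
  by apply: (integrand_le_cone p1 zetaM) => //; apply: cdk; exact: leq_addl.
by move=> _ _; rewrite integral0.
Qed.

Lemma delta_cvg0_epi (uk : nat -> 'rV[R]_n -> \bar R) u :
  (forall k, Conv_coe_n (uk k)) -> Conv_coe_n u ->
  (fun k => delta zeta p (uk k) u) @ \oo --> 0%E <-> epi_converges uk u.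
Proof.
move=> Cuk Cu; rewrite epi_convergesP; last by case: Cu.
split=> [dcvg|[low up]]; last exact: epi_delta_cvg0.
by split; [exact: delta_cvg0_lower|exact: delta_cvg0_upper].
Qed.

Lemma delta_eq0 u v : Conv_coe_n u -> Conv_coe_n v ->
  delta zeta p u v = 0%E <-> u = v.
Proof.
move=> Cu Cv; have [uNy _ lu _ _] := Cu; have [vNy _ lv _ _] := Cv.
split=> [uv0|->]; last exact: deltaxx.
(* The constant sequence [u] converges to [v]; together with the semicontinuity of [u], the two
   epi-convergence facts give both inequalities. *)
have dcvg : (fun=> delta zeta p u v) @ \oo --> 0%E by rewrite uv0; exact: cvg_cst.
have low := delta_cvg0_lower (fun=> Cu) Cv dcvg.
have up := delta_cvg0_upper (fun=> Cu) Cv dcvg.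
apply/funext => x; apply/eqP; rewrite eq_le; apply/andP; split.
  rewrite leNgt; apply/negP => /ereal_real_between[c [vxc cux]].
  have [V /nbhs_ballP[r /= r0 xrV] Vc] := lu x c cux.
  have [N _ /(_ N (leqnn N)) [y /xrV/Vc cuy]] := up x c r vxc r0.
  by rewrite ltNge (ltW cuy).
rewrite leNgt; apply/negP => /ereal_real_between[c [uxc cvx]].
have [r r0 [N _ /(_ N (leqnn N)) /(_ x (ballxx _ r0))]] := low x c cvx.
by rewrite ltNge (ltW uxc).
Qed.

End metric_epi.

Theorem theorem1p1 (R : realType) (n : nat) (p : R) (zeta : R -> R) :
  1 <= p -> M_class n p zeta ->
  (* delta_{zeta,p} is a metric on Conv_coe^(n)(R^n) *)
  (forall u v w : 'rV[R]_n -> \bar R,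
     Conv_coe_n u -> Conv_coe_n v -> Conv_coe_n w ->
     [/\ delta zeta p u v \is a fin_num,
         delta zeta p u v = 0%E <-> u = v,
         delta zeta p u v = delta zeta p v u &
         (delta zeta p u w <= delta zeta p u v + delta zeta p v w)%E]) /\
  (* metric convergence <-> epi-convergence *)
  (forall (uk : nat -> 'rV[R]_n -> \bar R) (u : 'rV[R]_n -> \bar R),
     (forall k, Conv_coe_n (uk k)) -> Conv_coe_n u ->
     ((fun k => delta zeta p (uk k) u) @ \oo --> 0%E <-> epi_converges uk u)).
Proof.
move=> p1 zetaM; split => [u v w Cu Cv Cw|uk u Cuk Cu]; last exact: delta_cvg0_epi.
split.
- exact: Conv_delta_fin.
- exact: delta_eq0.
- exact: deltaC.
- by apply: delta_triangle => //; [case: Cu|case: Cv|case: Cw].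
Qed.
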